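(* Let $n=M+2^M$ and let $\rho$ be the diagonal $n$-qubit state $\rho=\sum_{Q\in\{0,1\}^n}p(Q)|Q\rangle\langle Q|$ where, writing $\mathcal{P}([M])=\{I_1,\dots,I_{2^M}\}$ for an enumeration of the subsets of $[M]$, $p(Q)=2^{-M}$ if $Q_{M+j}=\mathrm{MAJ}(\{Q_i:i\in I_j\})$ for all $j\in[2^M]$ and $p(Q)=0$ otherwise. Let $\hat\rho_1,\dots,\hat\rho_N$ be classical snapshots of $\rho$ obtained from $N$ copies via random Pauli measurements, and for an observable $O$ let $a(O)=\frac1N\sum_{k=1}^N\mathrm{tr}(O\hat\rho_k)$. Consider the analyst that (1) queries $Z_1,\dots,Z_M$ and receives $a(Z_1),\dots,a(Z_M)$; (2) sets $I=\{i\in[M]:a(Z_i)\ge 9/\sqrt N\}$, lets $j^*$ be the index with $I_{j^*}=I$, and queries $Z_{M+j^*}$. There is a constant $c$ such that if $M\ge c\max(N,\log(1/\delta))$ and $N\ge c\log(1/\delta)$, then with probability at least $1-\delta$, $$|a(Z_{M+j^*})-\mathrm{tr}(Z_{M+j^*}\rho)|\ge0.99.$$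
   Context: $Z_i$ denotes Pauli $Z$ on qubit $i$ tensored with identity elsewhere. $\mathrm{MAJ}$ of a set of bits is $1$ if strictly more than half of them equal $1$ and $0$ otherwise (for $I_j=\emptyset$ the value is fixed to $0$). Random Pauli classical snapshot: for each qubit $j$ independently choose $U_j$ uniformly so as to measure in the $X$, $Y$ or $Z$ basis, measure $U\rho U^\dagger$ ($U=U_1\otimes\cdots\otimes U_n$) in the computational basis obtaining $\hat b\in\{0,1\}^n$, and set $\hat\rho=\bigotimes_{j=1}^n\big(3U_j^\dagger|\hat b_j\rangle\langle\hat b_j|U_j-\mathbb{I}\big)$; the $N$ snapshots come from $N$ independent copies. *)

(* Defs.v *)
From HB Require Import structures.
From mathcomp Require Import all_boot all_order all_algebra.
From mathcomp Require Import complex.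
From mathcomp Require Import reals exp.
Set Implicit Arguments. Unset Strict Implicit. Unset Printing Implicit Defensive.
Import Order.TTheory GRing.Theory Num.Theory.
Local Open Scope ring_scope.

Section Quantum.
Variable R : realType.
Local Notation C := (R[i]).

(* Operators on a finite-dimensional Hilbert space with computational basis T,
   given by their matrix entries <x|A|y>. *)
Definition mat (T : finType) := T -> T -> C.
Definition mmul (T : finType) (A B : mat T) : mat T :=
  fun x y => \sum_z A x z * B z y.
Definition adjm (T : finType) (A : mat T) : mat T := fun x y => (A y x)^*.
Definition trm (T : finType) (A : mat T) : C := \sum_x A x x.
Definition idm (T : finType) : mat T := fun x y => (x == y)%:R.

Definition tens (n : nat) (A : 'I_n -> mat bool) : mat {ffun 'I_n -> bool} :=
  fun x y => \prod_j A j (x j) (y j).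

Definition pauliZ : mat bool :=
  fun x y => if x == y then (if x then -1 else 1) else 0.
Definition Zq (n : nat) (i : 'I_n) : mat {ffun 'I_n -> bool} :=
  tens (fun j => if j == i then pauliZ else @idm _).

Definition hadamard : mat bool :=
  fun x y => (if x && y then -1 else 1) / (Num.sqrt (2 : R))%:C%C.
Definition sdag : mat bool :=
  fun x y => if x == y then (if x then - 'i%C else 1) else 0.
(* basis choice: 0 = X basis (U = H), 1 = Y basis (U = H S^dag), 2 = Z basis (U = I) *)
Definition basisU (u : 'I_3) : mat bool :=
  match val u with
  | 0 => hadamard
  | 1 => mmul hadamard sdag
  | _ => @idm _
  end.
Definition ketbra (b : bool) : mat bool := fun x y => ((x == b) && (y == b))%:R.

Definition snap1 (u : 'I_3) (b : bool) : mat bool :=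
  fun x y => 3 * mmul (adjm (basisU u)) (mmul (ketbra b) (basisU u)) x y - idm x y.
Definition snapshot (n : nat) (u : {ffun 'I_n -> 'I_3}) (b : {ffun 'I_n -> bool})
  : mat {ffun 'I_n -> bool} := tens (fun j => snap1 (u j) (b j)).

Definition born (n : nat) (rho : mat {ffun 'I_n -> bool})
  (u : {ffun 'I_n -> 'I_3}) (b : {ffun 'I_n -> bool}) : C :=
  let U := tens (fun j => basisU (u j)) in mmul U (mmul rho (adjm U)) b b.

(* one copy: basis choices and measurement outcomes; N copies: a sample space *)
Definition outcome (n : nat) := ({ffun 'I_n -> 'I_3} * {ffun 'I_n -> bool})%type.
Definition sample (n N : nat) := {ffun 'I_N -> outcome n}.

Definition pcopy (n : nat) (rho : mat {ffun 'I_n -> bool}) (o : outcome n) : C :=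
  ((3 ^ n)%:R)^-1 * born rho o.1 o.2.
Definition probN (n N : nat) (rho : mat {ffun 'I_n -> bool}) (E : pred (sample n N)) : C :=
  \sum_(w | E w) \prod_k pcopy rho (w k).

Definition aest (n N : nat) (w : sample n N) (O : mat {ffun 'I_n -> bool}) : C :=
  (N%:R)^-1 * \sum_k trm (mmul O (snapshot (w k).1 (w k).2)).

(* The hard state.  Qubits 'I_(M + 2^M): lshift i (i : 'I_M) are the first M
   qubits, rshift M j (j : 'I_(2^M)) is qubit M+j, associated to subset enumI j. *)
Definition maj (M : nat) (Q : {ffun 'I_(M + 2 ^ M) -> bool}) (I : {set 'I_M}) : bool :=
  (#|I| < 2 * #|[set i in I | Q (lshift (2 ^ M) i)]|)%N.
Definition pmaj (M : nat) (enumI : 'I_(2 ^ M) -> {set 'I_M})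
  (Q : {ffun 'I_(M + 2 ^ M) -> bool}) : C :=
  if [forall j, Q (rshift M j) == maj Q (enumI j)] then ((2 ^ M)%:R)^-1 else 0.
Definition rhoMaj (M : nat) (enumI : 'I_(2 ^ M) -> {set 'I_M})
  : mat {ffun 'I_(M + 2 ^ M) -> bool} :=
  fun Q Q' => if Q == Q' then pmaj enumI Q else 0.

Definition Isel (M N : nat) (w : sample (M + 2 ^ M) N) : {set 'I_M} :=
  [set i : 'I_M | (9 / Num.sqrt (N%:R : R))%:C%C <= aest w (Zq (lshift (2 ^ M) i))].

Definition failEvent (M N : nat) (enumI : 'I_(2 ^ M) -> {set 'I_M})
  (w : sample (M + 2 ^ M) N) : bool :=
  [forall j, (enumI j == Isel w) ==>
     ((99%:R / 100%:R : R)%:C%C <=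
       `| aest w (Zq (rshift M j)) - trm (mmul (Zq (rshift M j)) (rhoMaj enumI)) |)].
End Quantum.

(* Main.v *)
(* Since rho is diagonal, the experiment has a classical description: copy k
   carries hidden uniform bits q_k in {0,1}^M, a qubit measured in the Z basis
   reveals its bit, and in any other basis the outcome is a fair coin.  A qubit
   i is selected when its total spin over the N copies is at least 3 sqrt N,
   which has probability at least p0 > 0 uniformly in N >= 9, by a change of
   measure.  Selection biases each of the N hidden bits by order 1 / sqrt N, so
   for every set K of at least eps N copies the sum of the signs over K and the
   selected qubits is positive except with probability exp(- gap M).  A union
   bound over the 2^N sets K shows that the majority of the selected bits is 0
   in all but eps N copies.  The bases of qubit M + j* are independent of all
   this, hence its empirical mean is close to 1, whereas the true mean of a
   majority is O(|I|^(-1/2)).  For bounded N one only uses the event that every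
   copy of qubit M + j* is measured in the Z basis, of probability 3^(-N); for
   N < 9 no qubit can be selected, and the true mean is then 1. *)
Require Import Defs.
From HB Require Import structures.
From mathcomp Require Import all_boot all_order all_algebra.
From mathcomp Require Import complex.
From mathcomp Require Import reals exp.
From mathcomp Require Import perm sequences ring lra zify.
Import Order.TTheory GRing.Theory Num.Theory.
Local Open Scope ring_scope.
Set Implicit Arguments. Unset Strict Implicit. Unset Printing Implicit Defensive.

(** * Snapshot traces and Born probabilities for diagonal states *)

Section Quantum.
Variable R : realType.
Local Notation C := (R[i]).

(** Probability of outcome [b] when the basis state of bit [q] is measured in basis [u]; index 2 is
    the Z basis. *)
Definition meas (u : 'I_3) (b q : bool) : R :=
  if val u == 2%N then (b == q)%:R else 2^-1.

Lemma conj_real (x : R) : (x%:C%C : C)^* = x%:C%C.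
Proof. by rewrite -[LHS]/(conjc _) conjc_real. Qed.

Lemma conj_i : ('i%C : C)^* = - 'i%C.
Proof. by rewrite -[LHS]/(conjc _); apply/eqP; rewrite eq_complex /= oppr0 !eqxx. Qed.

Lemma hadamard_sq b q : hadamard R b q * (hadamard R b q)^* = (2^-1)%:C%C.
Proof.
rewrite /hadamard.
have -> : (if b && q then -1 else 1) / (Num.sqrt (2:R))%:C%C =
   ((if b && q then -1 else 1) / Num.sqrt (2:R))%:C%C :> C.
  by rewrite fmorph_div; case: (b && q); rewrite ?rmorphN rmorph1.
rewrite conj_real -rmorphM mulf_div -expr2 -expr2 sqr_sqrtr //.
by case: (b && q); rewrite ?sqrrN expr1n mul1r.
Qed.

Lemma basisU_sq u b q : basisU R u b q * (basisU R u b q)^* = (meas u b q)%:C%C.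
Proof.
rewrite /basisU /meas; case: u => [[|[|[|//]]] /= _].
- exact: hadamard_sq.
- rewrite /mmul big_bool /sdag.
  case: q => /=; rewrite mulr0 ?add0r ?addr0.
    rewrite rmorphM rmorphN /= conj_i mulrACA hadamard_sq.
    by rewrite opprK mulNr -expr2 sqr_i opprK mulr1.
  by rewrite rmorphM rmorph1 !mulr1 hadamard_sq.
- by rewrite /idm; case: eqP => _; rewrite ?rmorph1 ?rmorph0 ?mulr1 ?mulr0.
Qed.

Lemma trm_mul_tens n (A B : 'I_n -> mat R bool) :
  trm (mmul (tens A) (tens B)) = \prod_j trm (mmul (A j) (B j)).
Proof.
rewrite /trm /mmul /tens bigA_distr_bigA; apply: eq_bigr => x _.
rewrite (bigA_distr_bigA (fun j b => A j (x j) b * B j b (x j))).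
by apply: eq_bigr => y _; rewrite big_split.
Qed.

(** The diagonal suffices because the queried observables are diagonal. Conjugating the projector
    onto [b] leaves there the squared modulus of one entry of [basisU u], which is [meas]. *)
Lemma snap1_diag u b x : snap1 R u b x x = (3 * meas u b x - 1)%:C%C.
Proof.
have ketbraE z : mmul (ketbra R b) (basisU R u) z x = (z == b)%:R * basisU R u b x.
  rewrite /mmul (bigD1 b) //= big1 ?addr0; first by rewrite /ketbra eqxx andbT.
  by move=> y /negPf yb; rewrite /ketbra yb andbF mul0r.
rewrite /snap1 {1}/mmul (bigD1 b) //= big1 ?addr0; last first.
  by move=> z /negPf zb; rewrite ketbraE zb mul0r mulr0.
rewrite ketbraE eqxx mul1r /adjm [_^* * _]mulrC basisU_sq /idm eqxx.
by rewrite rmorphB rmorphM rmorph1 rmorph_nat.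
Qed.

Definition sgn (b : bool) : R := if b then -1 else 1.
(** Three times this value is the one-qubit snapshot estimate of Z; the factor 3 compensates for the
    probability [1/3] of the Z basis. *)
Definition spin (u : 'I_3) (b : bool) : R := if val u == 2%N then sgn b else 0.

Lemma trm_idm_snap1 u b : trm (mmul (@idm R bool) (snap1 R u b)) = 1.
Proof.
rewrite /trm /mmul !big_bool /idm /= !mul1r !mul0r add0r addr0 !snap1_diag /meas.
rewrite -rmorphD -(rmorph1 (real_complex R)); congr (_%:C%C).
by case: (val u == 2%N); case: b => /=; lra.
Qed.

Lemma trm_pauliZ_snap1 u b :
  trm (mmul (@pauliZ R) (snap1 R u b)) = (3 * spin u b)%:C%C.
Proof.
rewrite /trm /mmul !big_bool /pauliZ /= !mul1r !mulN1r !mul0r add0r addr0.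
rewrite !snap1_diag /meas /spin /sgn -rmorphN -rmorphD; congr (_%:C%C).
by case: (val u == 2%N); case: b => /=; lra.
Qed.

Lemma aest_Zq n N (w : sample n N) i :
  aest w (Zq R i) =
  (N%:R^-1 * \sum_k 3 * spin ((w k).1 i) ((w k).2 i))%:C%C.
Proof.
rewrite /aest rmorphM fmorphV rmorph_nat rmorph_sum; congr (_ * _).
apply: eq_bigr => k _; rewrite trm_mul_tens (bigD1 i) //= eqxx trm_pauliZ_snap1.
by rewrite big1 ?mulr1 // => j /negPf ->; exact: trm_idm_snap1.
Qed.

(** A diagonal state acts as a classical mixture: given the hidden string [z], the outcomes on
    distinct qubits are independent. *)
Lemma born_diag n (p : {ffun 'I_n -> bool} -> C) u b :
  born (fun x y => if x == y then p x else 0) u b =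
  \sum_z p z * (\prod_j meas (u j) (b j) (z j))%:C%C.
Proof.
rewrite /born /mmul; apply: eq_bigr => z _.
rewrite (bigD1 z) //= eqxx big1 ?addr0; last first.
  by move=> y yz; rewrite eq_sym (negPf yz) mul0r.
rewrite mulrCA; congr (_ * _).
rewrite /adjm /tens rmorph_prod rmorph_prod -big_split /=.
by apply: eq_bigr => j _; rewrite basisU_sq.
Qed.

Lemma Zq_diag n (i : 'I_n) x : Zq R i x x = (sgn (x i))%:C%C.
Proof.
rewrite /Zq /tens (bigD1 i) //= eqxx big1 ?mulr1; last first.
  by move=> j /negPf ->; rewrite /idm eqxx.
by rewrite /pauliZ eqxx /sgn; case: (x i); rewrite ?rmorphN rmorph1.
Qed.

Lemma trm_Zq_diag n (p : {ffun 'I_n -> bool} -> C) i :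
  trm (mmul (Zq R i) (fun x y => if x == y then p x else 0)) =
  \sum_(x : {ffun 'I_n -> bool}) (sgn (x i))%:C%C * p x.
Proof.
rewrite /trm /mmul; apply: eq_bigr => x _.
rewrite (bigD1 x) //= eqxx big1 ?addr0 ?Zq_diag //.
by move=> y /negPf ->; rewrite mulr0.
Qed.

End Quantum.

(** * Hidden-variable model of the N copies *)

Section HiddenModel.
Variables (R : realType) (M N : nat) (enumI : 'I_(2 ^ M) -> {set 'I_M}).
Local Notation n := (M + 2 ^ M)%N.
Local Notation bits := {ffun 'I_M -> bool}.
Local Notation T := ('I_3 * bool * bool)%type.
Local Notation S := ('I_3 * bool)%type.

Definition majority (I : {set 'I_M}) (q : bits) : bool :=
  (#|I| < 2 * #|[set i in I | q i]|)%N.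

Definition codeword (q : bits) : {ffun 'I_n -> bool} :=
  [ffun j => match split j with inl i => q i | inr j => majority (enumI j) q end].

Lemma codeword_l q i : codeword q (lshift (2 ^ M) i) = q i.
Proof. by rewrite ffunE (unsplitK (inl _)). Qed.

Lemma codeword_r q j : codeword q (rshift M j) = majority (enumI j) q.
Proof. by rewrite ffunE (unsplitK (inr _)). Qed.

Lemma maj_codeword q I : maj (codeword q) I = majority I q.
Proof.
rewrite /maj /majority; do 2 f_equal; apply: eq_card => i.
by rewrite !inE codeword_l.
Qed.

(** The support of [pmaj] is the set of codewords, each determined by its first [M] bits. *)
Lemma sum_pmaj (F : {ffun 'I_n -> bool} -> R[i]) :
  \sum_Q pmaj R enumI Q * F Q = (2 ^ M)%:R^-1 * \sum_q F (codeword q).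
Proof.
rewrite (bigID (fun Q : {ffun 'I_n -> bool} => [forall j, Q (rshift M j) == maj Q (enumI j)])) /=.
rewrite [X in _ + X]big1 ?addr0; last first.
  by move=> Q /negPf h; rewrite /pmaj h mul0r.
rewrite mulr_sumr.
rewrite (reindex_onto codeword (fun Q : {ffun 'I_n -> bool} => [ffun i => Q (lshift (2 ^ M) i)])) /=; last first.
  move=> Q /forallP h; apply/ffunP => j; rewrite -(splitK j).
  case: (split j) => k /=; first by rewrite codeword_l ffunE.
  rewrite codeword_r (eqP (h k)) /maj /majority; do 2 f_equal.
  by apply: eq_card => i; rewrite !inE ffunE.
have hq q : [forall j, codeword q (rshift M j) == maj (codeword q) (enumI j)].
  by apply/forallP => j; rewrite codeword_r maj_codeword.
apply: eq_big => [q|q _]; last by rewrite /pmaj hq.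
rewrite hq /=; apply/eqP/ffunP => i; by rewrite ffunE codeword_l.
Qed.

Lemma pcopy_rhoMaj (o : outcome n) :
  pcopy (rhoMaj R enumI) o =
  ((3 ^ n)%:R^-1 * (2 ^ M)%:R^-1 *
   \sum_q \prod_j meas R (o.1 j) (o.2 j) (codeword q j))%:C%C.
Proof.
rewrite /pcopy /rhoMaj born_diag sum_pmaj -mulrA !rmorphM !fmorphV !rmorph_nat.
by rewrite rmorph_sum.
Qed.

Lemma trm_Zq_rhoMaj j :
  trm (mmul (Zq R (rshift M j)) (rhoMaj R enumI)) =
  ((2 ^ M)%:R^-1 * \sum_q sgn R (majority (enumI j) q))%:C%C.
Proof.
rewrite /rhoMaj trm_Zq_diag.
under eq_bigr do rewrite mulrC.
rewrite sum_pmaj rmorphM fmorphV rmorph_nat rmorph_sum.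
by congr (_ * _); apply: eq_bigr => q _; rewrite codeword_r.
Qed.

(** Joint law of basis, outcome and hidden bit on one of the first [M] qubits: [1/6] is [1/3] for
    the basis times [1/2] for the bit. *)
Definition data_wt (t : T) : R := 6^-1 * meas R t.1.1 t.1.2 t.2.
(** Law of basis and outcome on a majority qubit [M + j], whose bit [y] is fixed by the hidden bits
    of the copy. *)
Definition parity_wt (y : bool) (s : S) : R := 3^-1 * meas R s.1 s.2 y.

(** Qubit first, copy second: the [M] rows are independent and identically distributed, which yields
    the bounds exponential in [M]. *)
Definition data := {ffun 'I_M -> {ffun 'I_N -> T}}.
Definition parity_data := {ffun 'I_(2 ^ M) -> {ffun 'I_N -> S}}.

Definition hidden (t : data) (k : 'I_N) : bits := [ffun i => (t i k).2].

Definition mk_sample (t : data) (s : parity_data) : sample n N :=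
  [ffun k =>
    ([ffun j => match split j with inl i => (t i k).1.1 | inr j => (s j k).1 end],
     [ffun j => match split j with inl i => (t i k).1.2 | inr j => (s j k).2 end])].

Lemma mk_sample_l t s k i :
  ((mk_sample t s k).1 (lshift _ i), (mk_sample t s k).2 (lshift _ i)) = (t i k).1.
Proof. by rewrite !ffunE /= ?ffunE !(unsplitK (inl _)) -surjective_pairing. Qed.

Lemma mk_sample_r t s k j :
  ((mk_sample t s k).1 (rshift _ j), (mk_sample t s k).2 (rshift _ j)) = s j k.
Proof. by rewrite !ffunE /= ?ffunE !(unsplitK (inr _)) -surjective_pairing. Qed.

Definition unmk_data (w : sample n N * {ffun 'I_N -> bits}) : data :=
  [ffun i => [ffun k => ((w.1 k).1 (lshift _ i), (w.1 k).2 (lshift _ i), w.2 k i)]].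
Definition unmk_parity (w : sample n N * {ffun 'I_N -> bits}) : parity_data :=
  [ffun j => [ffun k => ((w.1 k).1 (rshift _ j), (w.1 k).2 (rshift _ j))]].

Definition data_prob (t : data) : R := \prod_i \prod_k data_wt (t i k).
Definition parity_prob (t : data) (s : parity_data) : R :=
  \prod_j \prod_k parity_wt (majority (enumI j) (hidden t k)) (s j k).

(** Each copy is expanded over its hidden string; sample and hidden strings are then re-encoded as
    [data] and [parity_data], where the weight factors over qubits. *)
Lemma probN_rhoMaj (E : pred (sample n N)) :
  probN (rhoMaj R enumI) E =
  (\sum_t data_prob t * \sum_s parity_prob t s * (E (mk_sample t s))%:R)%:C%C.
Proof.
rewrite /probN big_mkcond /=.
transitivity ((\sum_(w : sample n N) \sum_(Q : {ffun 'I_N -> bits})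
   \prod_k ((3 ^ n)%:R^-1 * (2 ^ M)%:R^-1 *
      \prod_j meas R ((w k).1 j) ((w k).2 j) (codeword (Q k) j)) * (E w)%:R)%:C%C : R[i]).
  rewrite rmorph_sum; apply: eq_bigr => w _; rewrite -mulr_suml.
  have -> : \prod_k pcopy (rhoMaj R enumI) (w k) = (\sum_(Q : {ffun 'I_N -> bits})
   \prod_k ((3 ^ n)%:R^-1 * (2 ^ M)%:R^-1 *
      \prod_j meas R ((w k).1 j) ((w k).2 j) (codeword (Q k) j)))%:C%C.
    rewrite -(bigA_distr_bigA (fun k q => (3 ^ n)%:R^-1 * (2 ^ M)%:R^-1 *
      \prod_j meas R ((w k).1 j) ((w k).2 j) (codeword q j))).
    rewrite rmorph_prod; apply: eq_bigr => k _.
    by rewrite pcopy_rhoMaj mulr_sumr.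
  by case: (E w); rewrite /= ?mulr1 ?mulr0.
congr (_%:C%C).
rewrite pair_big /=.
under [RHS]eq_bigr do rewrite mulr_sumr.
rewrite [RHS]pair_big /=.
(* The hidden bits are stored inside [data], so this re-encoding is a bijection. *)
pose h (ts : data * parity_data) : sample n N * {ffun 'I_N -> bits} :=
  (mk_sample ts.1 ts.2, [ffun k => hidden ts.1 k]).
rewrite (reindex h) /=; last first.
  exists (fun w => (unmk_data w, unmk_parity w)) => [[t s]|[w Q]] _ /=.
    congr (_, _); apply/ffunP => i; rewrite !ffunE; apply/ffunP => k.
      by rewrite ffunE /= mk_sample_l !ffunE -surjective_pairing.
    by rewrite ffunE /= mk_sample_r.
  congr (_, _); apply/ffunP => k; last first.
    by rewrite !ffunE; apply/ffunP => i; rewrite !ffunE.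
  rewrite ffunE [RHS]surjective_pairing; congr (_, _); apply/ffunP => j; rewrite ffunE -[in RHS](splitK j);
    by case: (split j) => a; rewrite /unmk_data /unmk_parity !ffunE.
apply: eq_bigr => -[t s] _ /=; rewrite mulrA; congr (_ * _).
rewrite /data_prob /parity_prob exchange_big [X in _ = _ * X]exchange_big -big_split /=.
apply: eq_bigr => k _; rewrite big_split_ord /=.
rewrite /data_wt /parity_wt !big_split /= !prodr_const !card_ord.
(* The normalisations agree: [3^(M + 2^M) 2^M = 6^M 3^(2^M)]. *)
rewrite expnD natrM !natrX !exprVn -!invfM.
rewrite [in RHS]mulrACA; congr (_ * (_ * _)).
- rewrite -mulrA -invfM; congr (_^-1).
  by rewrite mulrCA [RHS]mulrC -exprMn -natrM.
- apply: eq_bigr => i _; rewrite codeword_l.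
  have -> : [ffun k0 => hidden t k0] k i = (t i k).2 by rewrite !ffunE.
  by have := mk_sample_l t s k i; case: (t i k) => -[u b] q [-> ->].
- apply: eq_bigr => j _; have := mk_sample_r t s k j; case: (s j k) => u b [-> ->].
  by rewrite codeword_r ffunE.
Qed.

End HiddenModel.

(** * Elementary inequalities for the exponential *)

Section ExpBounds.
Variable R : realType.
Implicit Type x : R.

Lemma expR_le_quadratic x : -1/3 <= x <= 1/3 -> expR x <= 1 + x + x ^+ 2.
Proof.
move=> /andP[x1 x2].
have h1 : expR (x / 2) * (1 - x / 2) <= 1.
  rewrite -[leRHS](expRxMexpNx_1 (x / 2)) ler_wpM2l ?expR_ge0 //.
  by have := expR_ge1Dx (- (x / 2)); lra.
have h2 : (expR (x / 2) * (1 - x / 2)) ^+ 2 <= 1.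
  by rewrite expr_le1 // mulr_ge0 ?expR_ge0 //; lra.
have e : expR x = expR (x / 2) ^+ 2 by rewrite expr2 -expRD; congr expR; lra.
have p : 0 < (1 - x / 2) ^+ 2 by rewrite exprn_gt0 //; lra.
rewrite -(ler_pM2r p) e -exprMn (le_trans h2) //.
(* [(1 + x + x^2) (1 - x/2)^2 - 1 = x^2 (1 - 3 x + x^2) / 4], nonnegative because [x <= 1/3]. *)
have : 0 <= x ^+ 2 * (1 - 3 * x + x ^+ 2).
  by rewrite mulr_ge0 ?sqr_ge0 //; have := sqr_ge0 x; lra.
by lra.
Qed.

(** From [exp x - 1 <= x exp x = x + x (exp x - 1)], the last product being bounded separately for
    each sign of [x]. *)
Lemma expR_le_sqr_exp x : expR x <= 1 + x + x ^+ 2 * expR `|x|.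
Proof.
have h : expR x - 1 <= x * expR x.
  have : expR x * (1 - x) <= 1.
    rewrite -[leRHS](expRxMexpNx_1 x) ler_wpM2l ?expR_ge0 //.
    by have := expR_ge1Dx (- x); lra.
  by rewrite mulrBr mulr1; lra.
have [x0|x0] := leP 0 x.
  rewrite ger0_norm //.
  have : x * (expR x - 1) <= x * (x * expR x) by exact: ler_wpM2l.
  by rewrite mulrA -expr2 mulrBr; lra.
have e1 : 1 <= expR `|x| by have := expR_ge1Dx `|x|; have := normr_ge0 x; lra.
have : x * (expR x - 1) <= x * x by apply: ler_wnM2l; [lra | have := expR_ge1Dx x; lra].
have : x ^+ 2 * 1 <= x ^+ 2 * expR `|x| by rewrite ler_wpM2l ?sqr_ge0.
by rewrite expr2 mulrBr; lra.
Qed.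

Lemma sqr_le_expR x : 0 <= x -> x ^+ 2 <= 16 * expR (x / 2).
Proof.
move=> x0; have e : expR (x / 2) = expR (x / 4) ^+ 2.
  by rewrite expr2 -expRD; congr expR; lra.
have h : x <= 4 * expR (x / 4) by have := expR_ge1Dx (x / 4); lra.
have -> : 16 * expR (x / 2) = (4 * expR (x / 4)) ^+ 2 by rewrite exprMn -e; lra.
by rewrite ler_sqr // nnegrE // mulr_ge0 ?expR_ge0.
Qed.

End ExpBounds.

(** * Expectation under a product weight *)

Section ProductExpectation.
Variables (R : numDomainType) (I T : finType) (m : T -> R).

Definition Ex (f : {ffun I -> T} -> R) : R :=
  \sum_(x : {ffun I -> T}) (\prod_i m (x i)) * f x.

Lemma eq_Ex f g : f =1 g -> Ex f = Ex g.
Proof. by move=> fg; apply: eq_bigr => x _; rewrite fg. Qed.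

Lemma Ex_prod (phi : I -> T -> R) :
  Ex (fun x => \prod_i phi i (x i)) = \prod_i \sum_t m t * phi i t.
Proof.
by rewrite bigA_distr_bigA; apply: eq_bigr => x _; rewrite big_split.
Qed.

Lemma ExD f g : Ex (fun x => f x + g x) = Ex f + Ex g.
Proof. by rewrite -big_split; apply: eq_bigr => x _; rewrite mulrDr. Qed.

Lemma ExZ c f : Ex (fun x => c * f x) = c * Ex f.
Proof. by rewrite mulr_sumr; apply: eq_bigr => x _; rewrite mulrCA. Qed.

Lemma Ex_sum (J : finType) (P : pred J) (F : J -> {ffun I -> T} -> R) :
  Ex (fun x => \sum_(j | P j) F j x) = \sum_(j | P j) Ex (F j).
Proof.
by rewrite exchange_big; apply: eq_bigr => x _; rewrite mulr_sumr.
Qed.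

Lemma Ex_cst c : \sum_t m t = 1 -> Ex (fun=> c) = c.
Proof.
move=> m1; transitivity (Ex (fun x => c * \prod_(i : I) (fun _ _ => 1) i (x i))).
  by apply: eq_Ex => x; rewrite big1 ?mulr1.
by rewrite ExZ (Ex_prod (fun _ _ => 1)) big1 ?mulr1 // => i _; under eq_bigr do rewrite mulr1.
Qed.

Hypothesis m_ge0 : forall t, 0 <= m t.

Lemma le_Ex f g : (forall x, f x <= g x) -> Ex f <= Ex g.
Proof. by move=> fg; apply: ler_sum => x _; rewrite ler_wpM2l ?prodr_ge0. Qed.

Lemma Ex_ge0 f : (forall x, 0 <= f x) -> 0 <= Ex f.
Proof. by move=> f0; apply: sumr_ge0 => x _; rewrite mulr_ge0 ?prodr_ge0. Qed.

Lemma Ex_ge_single (x : {ffun I -> T}) f : (forall y, 0 <= f y) -> (\prod_i m (x i)) * f x <= Ex f.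
Proof.
move=> f0; rewrite /Ex (bigD1 x) //= lerDl; apply: sumr_ge0 => y _.
by rewrite mulr_ge0 ?prodr_ge0.
Qed.

End ProductExpectation.

(** * One data qubit over the N copies: selection probability and induced bias *)

Section Row.
Variable R : realType.
Local Notation T := ('I_3 * bool * bool)%type.
Local Notation wt := (data_wt R).
Local Notation spinT t := (spin R t.1.1 t.1.2).

Lemma data_wt_ge0 t : 0 <= wt t.
Proof.
rewrite /data_wt /meas mulr_ge0 ?invr_ge0 //; case: ifP => _; last by rewrite invr_ge0.
by rewrite ler0n.
Qed.

Lemma sum_data_wt_spin (f : R -> R) :
  \sum_(t : T) wt t * f (spinT t) = 2 / 3 * f 0 + (f 1 + f (-1)) / 6.
Proof.
rewrite -(pair_bigA _ (fun a q => wt (a, q) * f (spinT (a, q)))) /=.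
rewrite -(pair_bigA _ (fun u b => \sum_q wt (u, b, q) * f (spin R u b))) /=.
rewrite !big_ord_recl big_ord0 !big_bool /data_wt /meas /spin /sgn /=.
by field.
Qed.

Lemma sum_data_wt_sgn (f : R -> R) :
  \sum_(t : T) wt t * f (sgn R t.2) = (f 1 + f (-1)) / 2.
Proof.
rewrite -(pair_bigA _ (fun a q => wt (a, q) * f (sgn R q))) /=.
rewrite -(pair_bigA _ (fun u b => \sum_q wt (u, b, q) * f (sgn R q))) /=.
rewrite !big_ord_recl big_ord0 !big_bool /data_wt /meas /spin /sgn /=.
by field.
Qed.

Lemma sum_data_wt : \sum_t wt t = 1.
Proof.
by have := sum_data_wt_spin (fun=> 1); under eq_bigr do rewrite mulr1; move=> ->; field.
Qed.

Variable N : nat.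
Local Notation row := {ffun 'I_N -> T}.
Local Notation rtN := (Num.sqrt (N%:R : R)).
Local Notation E := (@Ex R 'I_N T wt).

Definition total_spin (x : row) : R := \sum_k spinT (x k).
(** The estimate of [Z_i] is [3 total_spin / N], so the threshold [9 / sqrt N] becomes
    [3 sqrt N]. *)
Definition selected (x : row) : bool := 3 * rtN <= total_spin x.
Local Notation sel x := ((selected x)%:R : R).

Lemma Ex_iid (f : R -> R) : E (fun x => \prod_k f (spinT (x k))) =
  (2 / 3 * f 0 + (f 1 + f (-1)) / 6) ^+ N.
Proof.
by rewrite (Ex_prod _ (fun _ t => f (spinT t))) prodr_const card_ord sum_data_wt_spin.
Qed.

Lemma spin_cases u b : [\/ spin R u b = 0, spin R u b = 1 | spin R u b = -1].
Proof.
rewrite /spin /sgn; case: ifP => _; last by constructor 1.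
by case: b; [constructor 3|constructor 2].
Qed.

(** Under the tilt a single spin has mean [7 / r] and second moment [1/3], so each of the [N]
    factors is at most [1 + (1 + 21 s) / (3 N)]. The bound [21 <= r] keeps the tilted weights
    nonnegative. *)
Lemma tilt_le (r : R) : 21 <= r -> r ^+ 2 = N%:R ->
  forall s, s = 1 \/ s = -1 ->
  E (fun x => \prod_k ((1 + 21 / r * spinT (x k)) * expR (s / r * spinT (x k))))
    <= expR ((1 + 21 * s) / 3).
Proof.
move=> r21 rN s hs; have r0 : r != 0 by apply/eqP; lra.
have rp : 0 < r by lra.
rewrite (Ex_iid (fun y => (1 + 21 / r * y) * expR (s / r * y))).
rewrite !mulr0 expR0 addr0 !mulr1 mulrN1 mulrN1.
pose z := r^-1; have z0 : 0 < z by rewrite invr_gt0.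
have z1 : 21 * z <= 1 by rewrite ler_pdivrMr // mul1r.
have zN : z ^+ 2 * N%:R = 1 by rewrite -rN -exprMn mulVf ?expr1n.
have N0 : (N%:R : R) != 0 by rewrite -rN expf_neq0.
have -> : expR ((1 + 21 * s) / 3) = expR ((1 + 21 * s) / 3 * z ^+ 2) ^+ N.
  by rewrite -expRM_natr -(mulrA _ (z ^+ 2)) zN mulr1.
apply: lerXn2r; rewrite ?nnegrE ?expR_ge0 //.
  rewrite -/z addr_ge0 ?divr_ge0 ?addr_ge0 ?mulr_ge0 ?expR_ge0 //; lra.
apply: le_trans (expR_ge1Dx _).
have h1 : expR (s * z) <= 1 + s * z + z ^+ 2.
  have -> : z ^+ 2 = (s * z) ^+ 2 by rewrite exprMn; case: hs => ->; rewrite ?sqrrN expr1n mul1r.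
  by apply: expR_le_quadratic; case: hs => ->; lra.
have h2 : expR (- (s * z)) <= 1 - s * z + z ^+ 2.
  have -> : z ^+ 2 = (- (s * z)) ^+ 2.
    by rewrite sqrrN exprMn; case: hs => ->; rewrite ?sqrrN expr1n mul1r.
  by apply: expR_le_quadratic; case: hs => ->; lra.
have h3 : (1 + 21 * z) * expR (s * z) <= (1 + 21 * z) * (1 + s * z + z ^+ 2).
  by rewrite ler_wpM2l //; lra.
have h4 : (1 - 21 * z) * expR (- (s * z)) <= (1 - 21 * z) * (1 - s * z + z ^+ 2).
  by rewrite ler_wpM2l //; lra.
rewrite -/z; by lra.
Qed.

(** The first term bounds one explicit row for [N < 21^2]; the second comes from the change of
    measure for larger [N]. *)
Definition p0 : R := Num.min (6^-1 ^+ (21 ^ 2)) (expR (-231) / 2).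

Lemma p0_gt0 : 0 < p0.
Proof. by rewrite /p0 lt_min exprn_gt0 ?invr_gt0 //= divr_gt0 ?expR_gt0. Qed.

Lemma p0_le1 : p0 <= 1.
Proof.
rewrite /p0 ge_min; apply/orP; right.
have : expR (-231) <= 1 :> R by rewrite expR_le1; lra.
by have := expR_gt0 (-231 : R); lra.
Qed.

Lemma Ex_selected_small : (9 <= N < 21 ^ 2)%N -> p0 <= E (fun x => sel x).
Proof.
move=> /andP[N9 N21].
(* Every copy is measured in the Z basis with outcome 0: the total spin is [N], at least [3 sqrt N]
   once [N >= 9]. *)
pose x : row := [ffun=> (ord_max, false, false)].
apply: le_trans (Ex_ge_single data_wt_ge0 x _); last by move=> y; exact: ler0n.
have -> : \prod_k wt (x k) = 6^-1 ^+ N.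
  under eq_bigr do rewrite ffunE.
  by rewrite prodr_const card_ord /data_wt /meas /= mulr1.
have -> : selected x.
  rewrite /selected /total_spin; under eq_bigr do rewrite ffunE /spin /sgn /=.
  rewrite sumr_const card_ord.
  have e : (N%:R : R) = rtN ^+ 2 by rewrite sqr_sqrtr ?ler0n.
  rewrite [leRHS]e expr2 ler_wpM2r ?sqrtr_ge0 //.
  have : Num.sqrt (9%:R : R) <= rtN by rewrite ler_wsqrtr // ler_nat.
  have -> : (9%:R : R) = 3 ^+ 2 by rewrite -natrX.
  by rewrite sqrtr_sqr ger0_norm.
rewrite mulr1 /p0 ge_min; apply/orP; left.
by apply: ler_wiXn2l; rewrite ?invr_ge0 // ?invf_le1 //; [lra|exact: ltnW].
Qed.

Lemma expR_gt4 : 4 <= expR (11 / 3) :> R.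
Proof. by have := expR_ge1Dx (11 / 3 : R); lra. Qed.

(* Change of measure: under the law tilted by [1 + 21 spin / sqrt N] the mean of
   [total_spin] is [7 sqrt N], and the likelihood ratio is at most [exp 231]
   where [total_spin <= 11 sqrt N]. *)
Lemma Ex_selected_large : (21 ^ 2 <= N)%N -> p0 <= E (fun x => sel x).
Proof.
move=> N21; have rN : rtN ^+ 2 = N%:R by rewrite sqr_sqrtr ?ler0n.
have r21 : 21 <= rtN.
  have : Num.sqrt ((21 ^ 2)%:R : R) <= rtN by rewrite ler_wsqrtr // ler_nat.
  by rewrite natrX sqrtr_sqr ger0_norm.
pose r := rtN; have r0 : 0 < r by rewrite /r; lra.
pose L (x : row) := \prod_k (1 + 21 / r * spinT (x k)).
have lam1 : 21 / r <= 1 by rewrite ler_pdivrMr // mul1r.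
have lam0 : 0 < 21 / r by rewrite divr_gt0.
have fac_ge0 t : 0 <= 1 + 21 / r * spinT t.
  by case: (spin_cases t.1.1 t.1.2) => ->; lra.
have L_ge0 x : 0 <= L x by apply: prodr_ge0 => k _; exact: fac_ge0.
have L_le x : L x <= expR (21 / r * total_spin x).
  rewrite /total_spin mulr_sumr expR_sum; apply: ler_prod => k _.
  by rewrite fac_ge0 expR_ge1Dx.
have EL : E L = 1.
  by rewrite /L (Ex_iid (fun y => 1 + 21 / r * y)) -[RHS](expr1n _ N); congr (_ ^+ _); field; apply/eqP; lra.
pose tail s (x : row) := \prod_k ((1 + 21 / r * spinT (x k)) * expR (s / r * spinT (x k))).
have tailE s x : tail s x = L x * expR (s / r * total_spin x).
  by rewrite /tail big_split /= -expR_sum -mulr_sumr.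
(* The window from [3 r] to [11 r] is isolated by subtracting one exponential tail on each side;
   inside it [L <= exp 231], as [21 * 11 = 231]. *)
have pointwise x :
    expR (-231) * (L x + (- expR 3) * tail (-1) x + (- expR (-11)) * tail 1 x) <= sel x.
  rewrite !tailE.
  have [hS|hS] := boolP (selected x); last first.
    rewrite pmulr_rle0 ?expR_gt0 //.
    have : 1 <= expR 3 * expR (-1 / r * total_spin x).
      rewrite -expRD -[leLHS]expR0 ler_expR -mulrA addrC -subr_ge0 mulN1r.
      move: hS; rewrite /selected -/r -ltNge => hS.
      have : r^-1 * total_spin x <= 3 by rewrite mulrC ler_pdivrMr // ltW.
      by lra.
    move/(ler_wpM2l (L_ge0 x)).
    have := mulr_ge0 (L_ge0 x) (mulr_ge0 (expR_ge0 (-11)) (expR_ge0 (1 / r * total_spin x))).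
    by lra.
  have [hB|hB] := leP (total_spin x) (11 * r).
    have : L x <= expR 231.
      apply: le_trans (L_le x) _; rewrite ler_expR.
      rewrite mulrAC ler_pdivrMr //; lra.
    move=> hL; have e : expR (-231) * expR 231 = 1 :> R by rewrite mulrC expRxMexpNx_1.
    have : expR (-231) * L x <= 1 by rewrite -[leRHS]e ler_wpM2l ?expR_ge0.
    rewrite /=; move/(fun h => le_trans _ h); apply; rewrite ler_wpM2l ?expR_ge0 //.
    rewrite -addrA gerDl !mulNr -opprD oppr_le0.
    by rewrite addr_ge0 // !mulr_ge0 ?expR_ge0.
  apply: (@le_trans _ _ 0); last exact: ler0n.
  rewrite pmulr_rle0 ?expR_gt0 //.
  have : 1 <= expR (-11) * expR (1 / r * total_spin x).
    rewrite -expRD -[leLHS]expR0 ler_expR mul1r addrC.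
    have : 11 <= r^-1 * total_spin x by rewrite mulrC ler_pdivlMr // ltW.
    by lra.
  move/(ler_wpM2l (L_ge0 x)).
  have := mulr_ge0 (L_ge0 x) (mulr_ge0 (expR_ge0 3) (expR_ge0 (-1 / r * total_spin x))).
  by lra.
have := le_Ex data_wt_ge0 pointwise; rewrite ExZ !ExD !ExZ EL.
apply: le_trans; rewrite /p0 ge_min; apply/orP; right.
rewrite ler_wpM2l ?expR_ge0 //.
(* The cutoffs 3 and 11 lie symmetrically about the tilted mean 7, so both tails get the exponent
   [-11/3]. Each is at most [1/4], leaving half of the tilted mass. *)
have t1 := tilt_le r21 rN (or_intror (erefl (-1 : R))).
have t2 := tilt_le r21 rN (or_introl (erefl (1 : R))).
have e4 : expR (- (11 / 3)) <= 4^-1 :> R by rewrite expRN lef_pV2 ?posrE ?expR_gt0 ?expR_gt4.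
have h1 : expR 3 * E (tail (-1)) <= 4^-1.
  apply: le_trans e4; have -> : - (11 / 3) = 3 + (1 + 21 * -1) / 3 :> R by field.
  by rewrite (expRD 3) ler_wpM2l ?expR_ge0.
have h2 : expR (-11) * E (tail 1) <= 4^-1.
  apply: le_trans e4; have -> : - (11 / 3) = -11 + (1 + 21 * 1) / 3 :> R by field.
  by rewrite (expRD (-11)) ler_wpM2l ?expR_ge0.
lra.
Qed.

Lemma Ex_selected : (9 <= N)%N -> p0 <= E (fun x => sel x).
Proof.
move=> N9; have [N21|N21] := ltnP N (21 ^ 2)%N; last exact: Ex_selected_large.
by apply: Ex_selected_small; rewrite N9.
Qed.

(* Outside the Z basis the hidden bit is uniform and independent of the outcome,
   so flipping it cancels its contribution. *)
Lemma Ex_selected_sgn k :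
  E (fun x => sel x * sgn R (x k).2) = E (fun x => sel x * spinT (x k)).
Proof.
apply/eqP; rewrite -subr_eq0 -sumrB; apply/eqP.
pose flip (x : row) : row :=
  [ffun j => if (j == k) && (val (x j).1.1 != 2%N) then ((x j).1, ~~ (x j).2) else x j].
have flip1 x j : (flip x j).1 = (x j).1 by rewrite ffunE; case: ifP.
have flipK : involutive flip.
  move=> x; apply/ffunP => j; rewrite ffunE flip1.
  by case: ifP => h; rewrite ffunE h //= negbK; case: (x j).
have selF x : selected (flip x) = selected x.
  by congr (_ <= _); apply: eq_bigr => j _; rewrite flip1.
pose F (x : row) := (\prod_j wt (x j)) * (sel x * sgn R (x k).2) -
  (\prod_j wt (x j)) * (sel x * spinT (x k)).
rewrite -[LHS]/(\sum_x F x).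
(* The involution [flip] preserves the weight and the selection, and makes the sum equal to its own
   negative. *)
have E2 : \sum_x F x = - \sum_x F x.
  rewrite {1}(reindex_inj (inv_inj flipK)) -sumrN; apply: eq_bigr => x _.
  rewrite /F selF flip1 -!mulrBr.
  (* In the Z basis [F x] vanishes: either hidden bit and outcome differ and the weight is 0, or
     sign and spin coincide. *)
  have [z|nz] := eqVneq (val (x k).1.1) 2%N.
    have fx : flip x = x.
      apply/ffunP => j; rewrite ffunE; case: ifP => // /andP[/eqP-> ].
      by rewrite z.
    rewrite fx (bigD1 k) //= /data_wt /meas /spin z /=.
    by case: eqP => [->|_]; rewrite ?subrr !(mulr0, mul0r, oppr0).
  rewrite -mulrN -mulrN; congr (_ * (_ * _)).
    apply: eq_bigr => j _; rewrite ffunE; case: ifP => // /andP[/eqP-> h].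
    by rewrite /data_wt /meas (negPf h).
  rewrite ffunE eqxx nz /= /spin (negPf nz) /sgn.
  by case: ((x k).2); rewrite /= !subr0 ?opprK.
by lra.
Qed.

(** The copies are exchangeable and [selected] is symmetric in them. *)
Lemma Ex_selected_spin_sym k l :
  E (fun x => sel x * spinT (x k)) = E (fun x => sel x * spinT (x l)).
Proof.
pose h (x : row) : row := [ffun j => x (tperm k l j)].
have hK : involutive h.
  by move=> x; apply/ffunP => j; rewrite !ffunE tpermK.
rewrite /Ex (reindex_inj (inv_inj hK)); apply: eq_bigr => x _.
congr (_ * (_ * _)).
- rewrite [RHS](reindex_inj (@perm_inj _ (tperm k l))).
  by apply: eq_bigr => j _; rewrite ffunE.
- congr ((_ _)%:R); congr (_ <= _).
  rewrite /total_spin [RHS](reindex_inj (@perm_inj _ (tperm k l))).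
  by apply: eq_bigr => j _; rewrite ffunE.
- by rewrite ffunE tpermL.
Qed.

(** By exchangeability [N] times the correlation is the mean of [total_spin] on the selection event,
    where it is at least [3 sqrt N]. *)
Lemma Ex_selected_spin k : (9 <= N)%N ->
  3 * p0 <= rtN * E (fun x => sel x * spinT (x k)).
Proof.
move=> N9; have rN : rtN ^+ 2 = N%:R by rewrite sqr_sqrtr ?ler0n.
have r0 : 0 < rtN by rewrite sqrtr_gt0 ltr0n; apply: leq_trans N9.
rewrite -(ler_pM2l r0) [leRHS]mulrA -expr2 rN.
have -> : N%:R * E (fun x => sel x * spinT (x k)) = E (fun x => sel x * total_spin x).
  under [RHS]eq_Ex do rewrite mulr_sumr.
  rewrite Ex_sum (eq_bigr (fun=> E (fun x => sel x * spinT (x k)))).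
    by rewrite sumr_const card_ord mulr_natl.
  by move=> l _; exact: Ex_selected_spin_sym.
apply: (@le_trans _ _ (3 * rtN * E (fun x => sel x))).
  have := ler_wpM2l (ltW r0) (Ex_selected N9); lra.
rewrite -ExZ; apply: le_Ex; first exact: data_wt_ge0.
by move=> x; case: (boolP (selected x)) => [h|_]; rewrite ?mulr0 ?mul0r // mulr1 mul1r.
Qed.

(** With [b = 3 eps p0] this is [b^2 / (128 e)], the maximum over [a] of [a b - 32 e a^2]. *)
Definition mgf_gap (eps : R) : R := (3 * eps * p0) ^+ 2 / (128 * expR 1).

(** The hidden bits are independent and fair, so each factor is at most
    [cosh (1 / sqrt N) <= exp (1 / N)], and there are at most [N] of them. *)
Lemma Ex_expR_sgn (K : {set 'I_N}) s : (9 <= N)%N -> s = 1 \/ s = -1 ->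
  E (fun x => expR (s / rtN * \sum_(k in K) sgn R (x k).2)) <= expR 1.
Proof.
move=> N9 hs; have rN : rtN ^+ 2 = N%:R by rewrite sqr_sqrtr ?ler0n.
have r3 : 3 <= rtN.
  have : Num.sqrt ((3 ^ 2)%:R : R) <= rtN by rewrite ler_wsqrtr // ler_nat.
  by rewrite natrX sqrtr_sqr ger0_norm.
pose z := rtN^-1; have z0 : 0 < z by rewrite invr_gt0; lra.
have z1 : 3 * z <= 1 by rewrite ler_pdivrMr ?mul1r //; lra.
have zN : z ^+ 2 * N%:R = 1 by rewrite -rN -exprMn mulVf ?expr1n //; apply/eqP; lra.
under eq_Ex do rewrite mulr_sumr expR_sum big_mkcond /=.
rewrite (Ex_prod _ (fun k t => if k \in K then expR (s / rtN * sgn R t.2) else 1)).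
have -> : expR 1 = \prod_(k < N) expR (z ^+ 2) :> R.
  by rewrite prodr_const card_ord -expRM_natr zN.
apply: ler_prod => k _; case: (k \in K).
  rewrite (sum_data_wt_sgn (fun y => expR (s / rtN * y))) mulr1 mulrN1 -/z.
  rewrite divr_ge0 ?addr_ge0 ?expR_ge0 //=.
  apply: le_trans (expR_ge1Dx _).
  have q : z ^+ 2 = (s * z) ^+ 2 by rewrite exprMn; case: hs => ->; rewrite ?sqrrN expr1n mul1r.
  have h1 : expR (s * z) <= 1 + s * z + (s * z) ^+ 2.
    by apply: expR_le_quadratic; case: hs => ->; lra.
  have h2 : expR (- (s * z)) <= 1 - s * z + (- (s * z)) ^+ 2.
    by apply: expR_le_quadratic; case: hs => ->; lra.
  rewrite sqrrN in h2; rewrite q; lra.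
under eq_bigr do rewrite mulr1.
rewrite sum_data_wt ler01 /= -[leLHS]expR0 ler_expR sqr_ge0 //.
Qed.

(* The exponent has scale [1 / sqrt N], at which the second-order term is
   bounded uniformly in [K] while the mean is of order [eps]. *)
Lemma Ex_selected_mgf eps : (9 <= N)%N -> 0 < eps <= 1 ->
  exists2 lam, 0 <= lam & forall K : {set 'I_N}, eps * N%:R <= #|K|%:R ->
    E (fun x => expR (- (lam * (sel x * \sum_(k in K) sgn R (x k).2))))
      <= 1 - mgf_gap eps.
Proof.
move=> N9 /andP[eps0 eps1].
have rN : rtN ^+ 2 = N%:R by rewrite sqr_sqrtr ?ler0n.
have r0 : 0 < rtN by rewrite sqrtr_gt0 ltr0n; apply: leq_trans N9.
have e2 : 2 <= expR 1 :> R by have := expR_ge1Dx (1 : R); lra.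
have p00 := p0_gt0; have p01 := p0_le1.
have ep : 0 < eps * p0 <= 1.
  by rewrite mulr_gt0 //= mulr_ile1 // ltW.
(* The maximiser in the formula for [mgf_gap]. *)
pose a := 3 * eps * p0 / (64 * expR 1).
have D0 : 0 < 64 * expR 1 :> R by lra.
have aD : a * (64 * expR 1) = 3 * eps * p0 by rewrite /a divfK // gt_eqF.
have a0 : 0 < a by rewrite divr_gt0 //; lra.
have a12 : a <= 2^-1 by rewrite ler_pdivrMr //; lra.
have gapE : mgf_gap eps = 32 * expR 1 * a ^+ 2.
  by rewrite /mgf_gap -aD; field; rewrite gt_eqF // expR_gt0.
clearbody a.
exists (a / rtN); first by rewrite divr_ge0 // ltW.
move=> K hK; pose Y (x : row) := \sum_(k in K) sgn R (x k).2.
(* Second-order expansion with [z = |Y| / sqrt N]: since [a <= 1/2], [z^2 exp (a z) <= 16 exp z],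
   and [exp z] is at most the sum of the two signed exponentials. *)
have pointwise x : expR (- (a / rtN * (sel x * Y x))) <=
   1 + (- (a / rtN)) * (sel x * Y x) +
   16 * a ^+ 2 * (expR (1 / rtN * Y x) + expR (-1 / rtN * Y x)).
  have [hs|hs] := boolP (selected x); last first.
    rewrite !(mul0r, mulr0) oppr0 expR0 addr0 lerDl.
    by rewrite mulr_ge0 ?addr_ge0 ?expR_ge0 // mulr_ge0 ?sqr_ge0.
  rewrite /= !mul1r.
  apply: le_trans (expR_le_sqr_exp _) _; rewrite (mulNr (a / rtN)) lerD2l sqrrN normrN.
  pose z := `|Y x| / rtN.
  have z0 : 0 <= z by rewrite divr_ge0 // ltW.
  have e1 : (a / rtN * Y x) ^+ 2 = a ^+ 2 * z ^+ 2.
    by rewrite /z -exprMn -[LHS]real_normK ?num_real // !normrM (gtr0_norm a0) normfV (gtr0_norm r0); congr (_ ^+ 2); ring.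
  have e3 : `|a / rtN * Y x| = a * z.
    by rewrite !normrM (gtr0_norm a0) normfV (gtr0_norm r0) /z; ring.
  rewrite e1 e3 [16 * a ^+ 2]mulrC -(mulrA (a ^+ 2)) -(mulrA (a ^+ 2)).
  apply: ler_wpM2l; first exact: sqr_ge0.
  apply: (@le_trans _ _ (16 * expR z)).
    have -> : 16 * expR z = 16 * expR (z / 2) * expR (z / 2).
      by rewrite -mulrA -expRD; congr (_ * expR _); lra.
    by rewrite ler_pM ?sqr_ge0 ?expR_ge0 ?sqr_le_expR // ler_expR; nra.
  rewrite ler_wpM2l //.
  have [y0|y0] := leP 0 (Y x).
    have -> : z = rtN^-1 * Y x by rewrite /z ger0_norm // mulrC.
    by rewrite lerDl expR_ge0.
  have -> : z = -1 / rtN * Y x by rewrite /z ltr0_norm //; ring.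
  by rewrite lerDr expR_ge0.
apply: le_trans (le_Ex data_wt_ge0 pointwise) _.
rewrite !ExD !ExZ !ExD (Ex_cst _ _ sum_data_wt).
have m1 := Ex_expR_sgn K N9 (or_introl (erefl 1)).
have m2 := Ex_expR_sgn K N9 (or_intror (erefl (-1))).
have m3 : 16 * a ^+ 2 * (E (fun x => expR (1 / rtN * Y x)) + E (fun x => expR (-1 / rtN * Y x)))
    <= 16 * a ^+ 2 * (2 * expR 1).
  by rewrite ler_wpM2l ?mulr_ge0 ?sqr_ge0 //; rewrite /Y; lra.
(* Each of the at least [eps N] copies in [K] contributes at least [3 p0 / sqrt N] to the mean. *)
have m4 : 3 * eps * p0 <= (rtN)^-1 * E (fun x => sel x * Y x).
  under eq_Ex do rewrite mulr_sumr.
  rewrite Ex_sum ler_pdivlMl //.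
  apply: (@le_trans _ _ (\sum_(k in K) (rtN^-1 * (3 * p0)))).
    rewrite sumr_const -[leRHS]mulr_natr.
    have -> : rtN * (3 * eps * p0) = rtN^-1 * (3 * p0) * (eps * N%:R).
      have h (r n : R) : r != 0 -> r ^+ 2 = n ->
        r * (3 * eps * p0) = r^-1 * (3 * p0) * (eps * n) by move=> ? <-; field.
      by apply: h; rewrite ?gt_eqF.
    by rewrite ler_wpM2l // mulr_ge0 ?invr_ge0 ?sqrtr_ge0 //; lra.
  apply: ler_sum => k _; rewrite Ex_selected_sgn ler_pdivrMl //.
  exact: Ex_selected_spin.
rewrite gapE.
have m5 : a * (3 * eps * p0) <= a * (rtN^-1 * E (fun x => sel x * Y x)).
  by rewrite ler_wpM2l // ltW.
rewrite -aD in m5.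
move: m3 m5; rewrite /Y; lra.
Qed.

End Row.

(** * Mean sign of a majority of uniform bits *)

Section MajorityMean.
Variables (R : realType) (M : nat).
Local Notation bits := {ffun 'I_M -> bool}.
Implicit Types (I : {set 'I_M}) (q : bits).

Definition ones I q : nat := #|[set i in I | q i]|.

Lemma ones_flip I q : (ones I [ffun i => ~~ q i] + ones I q = #|I|)%N.
Proof.
rewrite addnC -(cardsID [set i | q i] I); congr addn; apply: eq_card => i.
  by rewrite !inE.
by rewrite !inE ffunE andbC.
Qed.

(** Flipping all bits exchanges strict majority and strict minority, so only ties survive; they have
    majority 0, hence sign 1. *)
Lemma sum_sgn_majority I :
  \sum_q sgn R (majority I q) = \sum_q ((2 * ones I q)%N == #|I|)%:R.
Proof.
have flipK : involutive (fun q : bits => [ffun i => ~~ q i]).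
  by move=> q; apply/ffunP => i; rewrite !ffunE negbK.
have e : \sum_q (#|I| < 2 * ones I q)%N%:R = \sum_q (2 * ones I q < #|I|)%N%:R :> R.
  rewrite (reindex_inj (inv_inj flipK)); apply: eq_bigr => q _; congr (_%:R).
  by have := ones_flip I q; lia.
apply/eqP; rewrite -subr_eq0 -sumrB; apply/eqP.
transitivity (\sum_q ((2 * ones I q < #|I|)%N%:R - (#|I| < 2 * ones I q)%N%:R : R)).
  apply: eq_bigr => q _; rewrite /sgn /majority -/(ones I q).
  by case: ltngtP => _; rewrite /=; lra.
by rewrite sumrB e subrr.
Qed.

(** Coefficient extraction from a generating polynomial: an index in [I] contributes a factor
    [X + 1], any other a factor 2. *)
Lemma sum_ones_eq I h : (h <= #|I|)%N ->
  \sum_q (ones I q == h)%:R = ('C(#|I|, h) * 2 ^ (M - #|I|))%:R :> R.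
Proof.
move=> hI; have gen : \sum_q 'X^(ones I q) = ('X + 1) ^+ #|I| * (2 ^ (M - #|I|))%:R :> {poly R}.
  transitivity (\prod_i \sum_b 'X^((i \in I) && b) : {poly R}).
    rewrite bigA_distr_bigA; apply: eq_bigr => q _; rewrite prodrXr; congr (_ ^+ _).
    rewrite /ones -sum1_card big_mkcond /=; apply: eq_bigr => i _.
    by rewrite inE; case: (_ && _).
  rewrite (bigID (mem I)) /= (eq_bigr (fun=> 'X + 1)); last first.
    by move=> i ->; rewrite big_bool /= expr0 expr1.
  rewrite prodr_const; congr (_ * _).
  rewrite (eq_bigr (fun=> 2%:R)); last first.
    by move=> i /negPf ->; rewrite big_bool /= expr0.
  rewrite prodr_const natrX; congr (_ ^+ _).
  have : (#|I| + #|[predC I]| = M)%N by rewrite cardC card_ord.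
  by move/(congr1 (subn^~ #|I|)); rewrite addKn.
have := congr1 (fun p : {poly R} => p`_h) gen.
rewrite /= coef_sum -polyC_natr coefMC exprD1n coef_sum.
rewrite (bigD1 (Ordinal (hI : (h < #|I|.+1)%N))) //= [X in _ + X]big1 ?addr0; last first.
  by move=> i; rewrite -val_eqE /= eq_sym => /negPf ih; rewrite coefMn coefXn ih mul0rn.
rewrite coefMn coefXn eqxx natrM => <-.
by apply: eq_bigr => q _; rewrite coefXn eq_sym.
Qed.

(** Probability of a tie among [2 h] fair bits. *)
Definition central h : R := 'C(2 * h, h)%:R / 4 ^+ h.

Lemma centralS h : central h.+1 = central h * (2 * h + 1)%:R / (2 * h + 2)%:R.
Proof.
have e : ('C(2 * h.+1, h.+1) * h.+1 = 2 * (2 * h + 1) * 'C(2 * h, h))%N.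
  have e1 := mul_bin_diag (2 * h.+1) h; have e2 := mul_bin_diag (2 * h + 1) h.
  have e3 : 'C(2 * h + 1, h) = 'C(2 * h + 1, h.+1).
    by rewrite -bin_sub; [congr 'C(_, _); lia | lia].
  have p1 : ((2 * h.+1).-1 = 2 * h + 1)%N by lia.
  have p2 : ((2 * h + 1).-1 = 2 * h)%N by lia.
  by rewrite p1 e3 in e1; rewrite p2 in e2; nia.
have e' : 'C(2 * h.+1, h.+1)%:R * h.+1%:R = 2 * (2 * h + 1)%:R * 'C(2 * h, h)%:R :> R.
  by rewrite -!natrM e.
rewrite /central exprS.
have h0 : (h.+1%:R : R) != 0 by rewrite pnatr_eq0.
have -> : (2 * h + 2)%:R = 2 * h.+1%:R :> R by rewrite -natrM; congr (_%:R); lia.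
have -> : 'C(2 * h.+1, h.+1)%:R = 2 * (2 * h + 1)%:R * 'C(2 * h, h)%:R / h.+1%:R :> R.
  by rewrite -e' mulfK.
have f0 : (4 ^+ h : R) != 0 by rewrite expf_neq0 // pnatr_eq0.
move: (h.+1%:R : R) h0 (4 ^+ h : R) f0 ((2 * h + 1)%:R : R) => a a0 b b0 d.
by field; rewrite a0 b0.
Qed.

(** By induction: with [y = 2 h + 1] one step multiplies the left side by
    [y (y + 2) / (y + 1)^2 <= 1]. *)
Lemma central_sqr h : central h ^+ 2 * (2 * h + 1)%:R <= 1.
Proof.
elim: h => [|h IH]; first by rewrite /central muln0 bin0 expr0 divr1 expr1n mulr1.
rewrite centralS; apply: le_trans IH.
have -> : (2 * h.+1 + 1)%:R = (2 * h + 1)%:R + 2 :> R.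
  by rewrite (_ : 2 * h.+1 + 1 = 2 * h + 1 + 2)%N ?natrD //; lia.
have -> : (2 * h + 2)%:R = (2 * h + 1)%:R + 1 :> R.
  by rewrite (_ : 2 * h + 2 = 2 * h + 1 + 1)%N ?natrD //; lia.
have y0 : 0 <= (2 * h + 1)%:R :> R by [].
move: ((2 * h + 1)%:R : R) y0 => y y0.
have -> : (central h * y / (y + 1)) ^+ 2 * (y + 2) =
   (central h ^+ 2 * y) * (y * (y + 2) / (y + 1) ^+ 2).
  by field; rewrite gt_eqF //; lra.
apply: ler_piMr; first by rewrite mulr_ge0 ?sqr_ge0.
rewrite ler_pdivrMr ?exprn_gt0 //; [nra|lra].
Qed.

Definition majority_mean I : R := (2 ^ M)%:R^-1 * \sum_q sgn R (majority I q).

Lemma majority_mean_sqr I : majority_mean I ^+ 2 * #|I|%:R <= 1.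
Proof.
rewrite /majority_mean sum_sgn_majority.
have [o|e] := boolP (odd #|I|).
  rewrite big1 ?mulr0 ?expr0n ?mul0r // => q _; case: eqP => // e.
  by move: o; rewrite -e mul2n odd_double.
pose h := (#|I|./2); have Ih : #|I| = (2 * h)%N.
  by rewrite mul2n -[LHS]odd_double_half (negPf e).
rewrite (eq_bigr (fun q => (ones I q == h)%:R)); last first.
  by move=> q _; rewrite Ih eqn_mul2l.
rewrite sum_ones_eq; last by rewrite Ih; lia.
have IM : (#|I| <= M)%N by rewrite -[leqRHS]card_ord max_card.
have -> : (2 ^ M)%:R^-1 * ('C(#|I|, h) * 2 ^ (M - #|I|))%:R = central h :> R.
  rewrite -{1}(subnK IM) expnD !natrM invfM mulrACA mulrC.
  rewrite [X in X * _]mulrC Ih /central.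
  have -> : (2 ^ (2 * h))%:R = 4 ^+ h :> R by rewrite expnM natrX.
  by field; rewrite !expf_neq0 // ?pnatr_eq0 ?expn_eq0.
rewrite Ih; apply: le_trans (central_sqr h).
by rewrite ler_wpM2l ?sqr_ge0 // ler_nat; lia.
Qed.

Lemma majority_mean_ge0 I : 0 <= majority_mean I.
Proof.
by rewrite mulr_ge0 ?invr_ge0 // sum_sgn_majority sumr_ge0.
Qed.

Lemma majority_mean0 : majority_mean set0 = 1.
Proof.
rewrite /majority_mean (eq_bigr (fun=> 1)); last first.
  by move=> q _; rewrite /majority cards0 (_ : [set _ in _ | _] = set0) ?cards0 //; apply/setP => i; rewrite !inE.
by rewrite sumr_const card_ffun card_bool card_ord mulVf // pnatr_eq0 expn_eq0.
Qed.

End MajorityMean.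

(** * From the selected set to the failure event *)

Section FailureEvent.
Variables (R : realType) (M N : nat) (enumI : 'I_(2 ^ M) -> {set 'I_M}).
Hypothesis enumI_bij : bijective enumI.
Hypothesis N_gt0 : (0 < N)%N.
Local Notation T := ('I_3 * bool * bool)%type.
Local Notation S := ('I_3 * bool)%type.
Local Notation data := (data M N).
Local Notation parity_data := (parity_data M N).
Implicit Types (t : data) (s : parity_data).

Definition chosen (t : data) : {set 'I_M} := [set i | selected R (t i)].
Definition isZ (o : S) : bool := val o.1 == 2%N.
Definition isZr (o : S) : R := (isZ o)%:R.

Lemma Isel_mk_sample t s : Isel R (mk_sample t s) = chosen t.
Proof.
apply/setP => i; rewrite !inE aest_Zq lecR /selected /total_spin.
have -> : \sum_k 3 * spin R ((mk_sample t s k).1 (lshift (2 ^ M) i))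
     ((mk_sample t s k).2 (lshift (2 ^ M) i)) =
    3 * \sum_k spin R (t i k).1.1 (t i k).1.2.
  rewrite mulr_sumr; apply: eq_bigr => k _; have := mk_sample_l t s k i.
  by case: (t i k) => -[u b] q [-> ->].
have rN : Num.sqrt (N%:R : R) ^+ 2 = N%:R by rewrite sqr_sqrtr ?ler0n.
have r0 : 0 < Num.sqrt (N%:R : R) by rewrite sqrtr_gt0 ltr0n.
rewrite -{2}rN; move: (Num.sqrt _) r0 (\sum_k _) => r r0 x.
rewrite ler_pdivrMr // expr2 invfM; have -> : r^-1 / r * (3 * x) * r = 3 * x / r.
  by field; rewrite gt_eqF.
by rewrite ler_pdivlMr //; apply/idP/idP; lra.
Qed.

(** Nonzero weight forces each Z-basis outcome on qubit [M + j] to equal the majority bit;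
    injectivity of [enumI] makes [j] the only index to check. *)
Lemma failEvent_mk_sample t s j : enumI j = chosen t ->
  parity_prob R enumI t s != 0 ->
  99 / 100 <= `| N%:R^-1 * (3 * \sum_k isZr (s j k) *
      sgn R (majority (chosen t) (hidden t k))) - majority_mean R (chosen t) | ->
  failEvent R enumI (mk_sample t s).
Proof.
move=> ej pn h; apply/forallP => j'; apply/implyP; rewrite Isel_mk_sample => /eqP ej'.
have -> : j' = j by apply: (bij_inj enumI_bij); rewrite ej ej'.
rewrite trm_Zq_rhoMaj aest_Zq -rmorphB normc_def /= expr0n addr0 sqrtr_sqr lecR ej.
move: h; congr (_ <= `|_ - _|); congr (_ * _); rewrite mulr_sumr.
apply: eq_bigr => k _; congr (_ * _).
have := mk_sample_r t s k j; rewrite [s j k]surjective_pairing => -[-> ->].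
move: pn; rewrite /parity_prob (bigD1 j) //= mulf_eq0 negb_or => /andP[+ _].
rewrite (bigD1 k) //= mulf_eq0 negb_or => /andP[+ _].
rewrite /parity_wt mulf_eq0 negb_or /meas /spin /isZr /isZ ej => /andP[_].
case: (val _ == 2%N); last by rewrite mul0r.
by case: ((s j k).2 =P _) => [->|_]; rewrite ?mul1r // eqxx.
Qed.

Lemma parity_prob_ge0 t s : 0 <= parity_prob R enumI t s.
Proof.
apply: prodr_ge0 => j _; apply: prodr_ge0 => k _.
rewrite /parity_wt /meas mulr_ge0 ?invr_ge0 //; case: ifP => _; last by rewrite invr_ge0.
exact: ler0n.
Qed.

Lemma sum_parity_wt y (f : R -> R) :
  \sum_(o : S) parity_wt R y o * f (isZr o) = f 1 / 3 + 2 / 3 * f 0.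
Proof.
rewrite -(pair_bigA _ (fun u b => parity_wt R y (u, b) * f (isZr (u, b)))) /=.
rewrite !big_ord_recl big_ord0 !big_bool /parity_wt /meas /isZr /isZ /=.
by case: y => /=; field.
Qed.

(** Whatever [t] is, the Z-basis indicators of qubit [j] are independent with probability [1/3]; all
    other majority qubits sum to 1. *)
Lemma sum_parity_prob t j (f : R -> R) :
  \sum_s parity_prob R enumI t s * \prod_k f (isZr (s j k)) =
  (f 1 / 3 + 2 / 3 * f 0) ^+ N.
Proof.
pose y j' k := majority (enumI j') (hidden t k).
pose F j' (x : {ffun 'I_N -> S}) := (\prod_k parity_wt R (y j' k) (x k)) *
   (if j' == j then \prod_k f (isZr (x k)) else 1).
transitivity (\prod_j' \sum_x F j' x).
  rewrite bigA_distr_bigA; apply: eq_bigr => s _; rewrite big_split /=.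
  by congr (_ * _); rewrite -big_mkcond big_pred1_eq.
have E j' (g : R -> R) : \sum_(x : {ffun 'I_N -> S})
    (\prod_k parity_wt R (y j' k) (x k)) * \prod_k g (isZr (x k)) =
    (g 1 / 3 + 2 / 3 * g 0) ^+ N.
  transitivity (\prod_k \sum_o parity_wt R (y j' k) o * g (isZr o)).
    by rewrite bigA_distr_bigA; apply: eq_bigr => x _; rewrite [RHS]big_split.
  under eq_bigr do rewrite sum_parity_wt.
  by rewrite prodr_const card_ord.
rewrite (bigD1 j) //= [X in _ * X]big1 ?mulr1; first by rewrite /F eqxx E.
move=> j' /negPf nj; rewrite /F nj.
have := E j' (fun=> 1); have -> : 1 / 3 + 2 / 3 * 1 = 1 :> R by field.
rewrite expr1n => h; rewrite -[RHS]h; apply: eq_bigr => x _.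
by rewrite [X in _ = _ * X]big1.
Qed.

Lemma data_prob_ge0 (t : data) : 0 <= data_prob R t.
Proof. by apply: prodr_ge0 => i _; apply: prodr_ge0 => k _; exact: data_wt_ge0. Qed.

Lemma sum_data_prob (f : {ffun 'I_N -> T} -> R) :
  \sum_(t : data) data_prob R t * \prod_i f (t i) = Ex (data_wt R) f ^+ M.
Proof.
rewrite -[M in RHS]card_ord -prodr_const /Ex bigA_distr_bigA.
by apply: eq_bigr => t _; rewrite big_split.
Qed.

Lemma sum_data_prob1 : \sum_(t : data) data_prob R t = 1.
Proof.
have := sum_data_prob (fun=> 1); rewrite (Ex_cst _ _ (sum_data_wt R)) expr1n => h.
by rewrite -[RHS]h; apply: eq_bigr => t _; rewrite big1_eq mulr1.
Qed.

(* The bases of qubit [M + j*] are independent of the data that determine [j*]. *)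
Lemma probN_fail_ge (G : pred data) beta :
  (forall t j, G t -> enumI j = chosen t ->
    beta <= \sum_s parity_prob R enumI t s * (failEvent R enumI (mk_sample t s))%:R) ->
  ((\sum_t data_prob R t * (G t)%:R) * beta)%:C%C <= probN (rhoMaj R enumI) (@failEvent R M N enumI).
Proof.
move=> h; rewrite probN_rhoMaj lecR mulr_suml; apply: ler_sum => t _.
rewrite -mulrA ler_wpM2l ?data_prob_ge0 //.
case: (boolP (G t)) => Gt; rewrite ?mul0r ?mul1r.
  have [g _ gK] := enumI_bij.
  exact: (h t (g (chosen t)) Gt (gK _)).
by apply: sumr_ge0 => s _; rewrite mulr_ge0 ?parity_prob_ge0.
Qed.

(** The copies whose Z outcome on qubit [M + j*] would be [-1]. *)
Definition errs (t : data) : {set 'I_N} := [set k | majority (chosen t) (hidden t k)].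

Lemma sum_isZr_sgn_ge t s j :
  \sum_k isZr (s j k) - 2 * #|errs t|%:R <=
  \sum_k isZr (s j k) * sgn R (majority (chosen t) (hidden t k)).
Proof.
have -> : 2 * #|errs t|%:R = \sum_k 2 * (majority (chosen t) (hidden t k))%:R :> R.
  rewrite -mulr_sumr -natr_sum; congr (_ * _%:R).
  by rewrite -sum1_card big_mkcond; apply: eq_bigr => k _; rewrite inE; case: majority.
rewrite -sumrB; apply: ler_sum => k _; rewrite /isZr /sgn.
by case: (isZ _); case: (majority _ _) => /=; lra.
Qed.

Lemma all_Z_ge t j (P : parity_data -> bool) :
  (forall s, parity_prob R enumI t s != 0 -> (forall k, isZ (s j k)) -> P s) ->
  3^-1 ^+ N <= \sum_s parity_prob R enumI t s * (P s)%:R.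
Proof.
move=> h; have := sum_parity_prob t j (fun y => y).
rewrite mulr0 addr0 mul1r => <-; apply: ler_sum => s _.
have [->|p0] := eqVneq (parity_prob R enumI t s) 0; first by rewrite !mul0r.
rewrite ler_wpM2l ?parity_prob_ge0 //.
have [a|na] := boolP [forall k, isZ (s j k)].
  rewrite (h s p0 (forallP a)) /isZr big1 // => k _.
  by rewrite (forallP a k).
move: na; rewrite negb_forall => /existsP[k /negPf nk].
by rewrite (bigD1 k) //= /isZr nk mul0r ler0n.
Qed.

(** Chernoff lower tail. The centred indicator has mean 0, so its exponential moment at [th] is at
    most [1 + th^2]; [th = tau / 2] minimises [th^2 - th tau]. *)
Lemma many_Z_ge t j (P : parity_data -> bool) tau : 0 <= tau <= 3^-1 ->
  (forall s, parity_prob R enumI t s != 0 ->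
     (3^-1 - tau) * N%:R <= \sum_k isZr (s j k) -> P s) ->
  1 - expR (- (tau ^+ 2 / 4) * N%:R) <= \sum_s parity_prob R enumI t s * (P s)%:R.
Proof.
move=> /andP[tau0 tau1] h; pose th : R := tau / 2.
have th0 : 0 <= th by rewrite /th; lra.
have th1 : th <= 3^-1 by rewrite /th; lra.
have rateE : - (tau ^+ 2 / 4) = - (th * tau) + th ^+ 2 by rewrite /th; field.
clearbody th.
pose f (y : R) := expR (th * (3^-1 - tau - y)).
have fS s : \prod_k f (isZr (s j k)) =
    expR (th * ((3^-1 - tau) * N%:R - \sum_k isZr (s j k))).
  rewrite /f -expR_sum -mulr_sumr sumrB sumr_const card_ord.
  by rewrite -[(_ - tau) *+ _]mulr_natr.
have bnd : f 1 / 3 + 2 / 3 * f 0 <= expR (- (tau ^+ 2 / 4)).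
  have split y : f y = expR (- (th * tau)) * expR (th * (3^-1 - y)).
    by rewrite -expRD; congr expR; ring.
  rewrite !split.
  rewrite rateE (expRD (- (th * tau))).
  have e1 : expR (th * (3^-1 - 1)) <= 1 + th * (3^-1 - 1) + (th * (3^-1 - 1)) ^+ 2.
    by apply: expR_le_quadratic; lra.
  have e0 : expR (th * (3^-1 - 0)) <= 1 + th * (3^-1 - 0) + (th * (3^-1 - 0)) ^+ 2.
    by apply: expR_le_quadratic; lra.
  move: (expR (th * (3^-1 - 1))) (expR (th * (3^-1 - 0))) e1 e0 => X1 X0 e1 e0.
  have -> : forall c : R, c * X1 / 3 + 2 / 3 * (c * X0) = c * (X1 / 3 + 2 / 3 * X0).
    by move=> c; ring.
  rewrite ler_wpM2l ?expR_ge0 //.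
  apply: le_trans (expR_ge1Dx _).
  by have := sqr_ge0 th; rewrite !exprMn in e0 e1; lra.
have f0 y : 0 <= f y by exact: expR_ge0.
have := sum_parity_prob t j f; have one := sum_parity_prob t j (fun=> 1).
have e1 : 1 / 3 + 2 / 3 * 1 = 1 :> R by field.
rewrite e1 expr1n in one => tot.
rewrite expRM_natr.
have : \sum_s parity_prob R enumI t s * (1 - \prod_k f (isZr (s j k))) <=
       \sum_s parity_prob R enumI t s * (P s)%:R.
  apply: ler_sum => s _.
  have [->|p0] := eqVneq (parity_prob R enumI t s) 0; first by rewrite !mul0r.
  rewrite ler_wpM2l ?parity_prob_ge0 // fS.
  have [a|na] := leP ((3^-1 - tau) * N%:R) (\sum_k isZr (s j k)).
    by rewrite (h s p0 a) lerBlDr lerDl expR_ge0.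
  apply: (@le_trans _ _ 0); last exact: ler0n.
  rewrite subr_le0 -[leLHS]expR0 ler_expR mulr_ge0 //; lra.
apply: le_trans.
have -> : \sum_s parity_prob R enumI t s * (1 - \prod_k f (isZr (s j k))) =
   1 - (f 1 / 3 + 2 / 3 * f 0) ^+ N.
  rewrite -tot -[X in _ = X - _]one -sumrB; apply: eq_bigr => s _.
  by rewrite big1_eq mulrBr mulr1.
rewrite lerD2l lerN2; apply: lerXn2r; rewrite ?nnegrE ?expR_ge0 //.
by rewrite addr_ge0 // ?divr_ge0 // mulr_ge0 // divr_ge0.
Qed.

Definition few_errs (eps L : R) (t : data) : bool :=
  (#|errs t|%:R < eps * N%:R) && (L <= #|chosen t|%:R).

Lemma majority_mean_small t : few_errs 6000^-1 (250 ^+ 2) t -> majority_mean R (chosen t) <= 250^-1.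
Proof.
case/andP=> _ hL; have := majority_mean_sqr R (chosen t).
have := majority_mean_ge0 R (chosen t); move: (majority_mean _ _) => mu mu0 h.
rewrite -(@ler_sqr _ mu) ?nnegrE ?invr_ge0 // exprVn.
rewrite -[leRHS]mul1r ler_pdivlMr ?exprn_gt0 //.
by apply: le_trans h; rewrite ler_wpM2l ?sqr_ge0.
Qed.

(** The estimate is at least [3 (1/3 - 1/600) - 6/6000 = 0.994] and the true mean at most
    [1/250 = 0.004], leaving exactly [0.99]. *)
Lemma few_errs_fail t j s : few_errs 6000^-1 (250 ^+ 2) t -> enumI j = chosen t ->
  parity_prob R enumI t s != 0 ->
  (3^-1 - 600^-1) * N%:R <= \sum_k isZr (s j k) -> failEvent R enumI (mk_sample t s).
Proof.
move=> G ej pn hV; apply: (failEvent_mk_sample ej pn).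
have mu := majority_mean_small G; have /andP[hB _] := G.
have Np : (0 : R) < N%:R by rewrite ltr0n.
apply: le_trans (ler_norm _).
have := sum_isZr_sgn_ge t s j => hS.
have : 994 / 1000 <= N%:R^-1 * (3 * \sum_k isZr (s j k) * sgn R (majority (chosen t) (hidden t k))).
  by rewrite ler_pdivlMl //; lra.
by lra.
Qed.

Lemma few_errs_all_Z t j s : few_errs 6000^-1 (250 ^+ 2) t -> enumI j = chosen t ->
  parity_prob R enumI t s != 0 -> (forall k, isZ (s j k)) ->
  failEvent R enumI (mk_sample t s).
Proof.
move=> G ej pn hZ; apply: (few_errs_fail G ej pn).
rewrite (eq_bigr (fun=> 1)); last by move=> k _; rewrite /isZr hZ.
rewrite sumr_const card_ord; have : (0 : R) < N%:R by rewrite ltr0n.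
by lra.
Qed.

(** The total spin is at most [N = sqrt N sqrt N < 3 sqrt N]. *)
Lemma chosen_small t : (N < 9)%N -> chosen t = set0.
Proof.
move=> N9; apply/setP => i; rewrite !inE; apply/negbTE; rewrite -ltNge.
have rN : Num.sqrt (N%:R : R) ^+ 2 = N%:R by rewrite sqr_sqrtr ?ler0n.
have r0 : 0 < Num.sqrt (N%:R : R) by rewrite sqrtr_gt0 ltr0n.
have r3 : Num.sqrt (N%:R : R) < 3.
  rewrite -(@ltr_sqr _ _ 3) ?nnegrE ?sqrtr_ge0 // rN -natrX ltr_nat; exact: N9.
apply: (@le_lt_trans _ _ N%:R).
  have -> : N%:R = \sum_(k < N) 1 :> R by rewrite sumr_const card_ord.
  by apply: ler_sum => k _; case: (spin_cases R (t i k).1.1 (t i k).1.2) => ->; lra.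
by rewrite -{1}rN expr2 ltr_pM2r.
Qed.

(** The empty majority is constantly 0, so the estimate is 3 and the true mean 1. *)
Lemma small_all_Z t j s : (N < 9)%N -> enumI j = chosen t ->
  parity_prob R enumI t s != 0 -> (forall k, isZ (s j k)) ->
  failEvent R enumI (mk_sample t s).
Proof.
move=> N9 ej pn hZ; apply: (failEvent_mk_sample ej pn).
rewrite (chosen_small _ N9) majority_mean0 (eq_bigr (fun=> 1)); last first.
  move=> k _; rewrite /isZr hZ mul1r /majority cards0.
  by rewrite (_ : [set _ in _ | _] = set0) ?cards0 //; apply/setP => i; rewrite !inE.
rewrite sumr_const card_ord mulrCA mulVf ?pnatr_eq0 -?lt0n // mulr1.
by rewrite ger0_norm; lra.
Qed.

(** Union bound: the first term covers the at most [2^N] candidate sets of erring copies, the second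
    the event that fewer than [L] qubits are chosen. *)
Lemma few_errs_prob eps L : (9 <= N)%N -> 0 < eps <= 1 ->
  1 - (2 ^+ N * expR (- (mgf_gap eps * M%:R)) + expR (L - p0 R / 2 * M%:R))
   <= \sum_(t : data) data_prob R t * (few_errs eps L t)%:R.
Proof.
move=> N9 eps01.
have [lam lam0 mgf] := Ex_selected_mgf N9 eps01.
pose W (K : {set 'I_N}) (x : {ffun 'I_N -> T}) : R :=
  (selected R x)%:R * \sum_(k in K) sgn R (x k).2.
pose f1 K x := expR (- (lam * W K x)).
pose f2 (x : {ffun 'I_N -> T}) : R := expR (- (selected R x)%:R).
pose bad (t : data) := \sum_(K : {set 'I_N} | eps * N%:R <= #|K|%:R) \prod_i f1 K (t i)
   + expR (L) * \prod_i f2 (t i).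
have few_or_bad t : 1 - bad t <= (few_errs eps L t)%:R.
  have b1 : 0 <= \sum_(K : {set 'I_N} | eps * N%:R <= #|K|%:R) \prod_i f1 K (t i).
    by apply: sumr_ge0 => K _; apply: prodr_ge0 => i _; exact: expR_ge0.
  have b2 : 0 <= expR (L) * \prod_i f2 (t i).
    by rewrite mulr_ge0 ?expR_ge0 //; apply: prodr_ge0 => i _; exact: expR_ge0.
  rewrite /few_errs /bad; case: ltP => hB /=; last first.
    (* With too many errors the term [K = errs t] already reaches 1: on each erring copy the signs
       of the chosen qubits sum to at most 0. *)
    rewrite lerBlDr add0r ler_wpDr // (bigD1 (errs t)) //=.
    apply: ler_wpDr.
      by apply: sumr_ge0 => K _; apply: prodr_ge0 => i _; exact: expR_ge0.
    rewrite /f1 -expR_sum -[leLHS]expR0 ler_expR sumrN oppr_ge0 -mulr_sumr.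
    rewrite mulr_ge0_le0 // /W.
    under eq_bigr do rewrite mulr_sumr.
    rewrite exchange_big /=; apply: sumr_le0 => k; rewrite inE => maj_k.
    have -> : \sum_i (selected R (t i))%:R * sgn R (t i k).2 =
       #|chosen t|%:R - 2 * (ones (chosen t) (hidden t k))%:R.
      have -> : #|chosen t|%:R = \sum_i (selected R (t i))%:R :> R.
        rewrite -natr_sum -sum1_card big_mkcond; congr (_%:R).
        by apply: eq_bigr => i _; rewrite inE; case: (selected _ _).
      have -> : (ones (chosen t) (hidden t k))%:R =
          \sum_i (selected R (t i) && (t i k).2)%:R :> R.
        rewrite -natr_sum /ones -sum1_card big_mkcond; congr (_%:R).
        by apply: eq_bigr => i _; rewrite !inE ffunE; case: (_ && _).
      rewrite mulr_sumr -sumrB; apply: eq_bigr => i _.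
      by rewrite /sgn; case: (selected _ _); case: ((t i k).2) => /=; lra.
    rewrite subr_le0 -natrM ler_nat ltnW //.
  have [hL|hL] := leP L #|chosen t|%:R.
    by rewrite /= lerBlDr lerDl addr_ge0.
  (* The product of the [f2] is [exp (- #|chosen t|)], with [#|chosen t| < L] in this case. *)
  have : 1 <= expR (L) * \prod_i f2 (t i); last first.
    by move=> h; rewrite subr_le0 ler_wpDl.
  rewrite /f2 -expR_sum -expRD -[leLHS]expR0 ler_expR sumrN subr_ge0 ltW //.
  apply: le_lt_trans hL; rewrite -sum1_card natr_sum [leRHS]big_mkcond /=.
  by apply: ler_sum => i _; rewrite inE; case: (selected _ _).
have pe (K : {set 'I_N}) : eps * N%:R <= #|K|%:R -> Ex (data_wt R) (f1 K) <= expR (- mgf_gap eps).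
  by move=> hK; apply: le_trans (mgf K hK) (expR_ge1Dx _).
have ps : Ex (data_wt R) f2 <= expR (- (p0 R / 2)).
  apply: le_trans (expR_ge1Dx _).
  (* Since [exp (-1) <= 1/2], the exponential of the indicator is dominated by an affine function,
     whose mean is at most [1 - p0 / 2]. *)
  have pw x : f2 x <= 1 + (- 2^-1) * (selected R x)%:R.
    rewrite /f2; case: (selected R x) => /=; last by rewrite oppr0 expR0; lra.
    have e2 : 2 <= expR 1 :> R by have := expR_ge1Dx (1 : R); lra.
    have : expR (-1) <= 2^-1 :> R by rewrite expRN lef_pV2 ?posrE ?expR_gt0.
    by lra.
  apply: le_trans (le_Ex (data_wt_ge0 R) pw) _.
  rewrite ExD ExZ (Ex_cst _ _ (sum_data_wt R)).
  by have := Ex_selected R N9; lra.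
apply: (@le_trans _ _ (\sum_(t : data) data_prob R t * (1 - bad t))); last first.
  by apply: ler_sum => t _; rewrite ler_wpM2l ?data_prob_ge0.
have -> : \sum_(t : data) data_prob R t * (1 - bad t) = 1 - \sum_t data_prob R t * bad t.
  by rewrite -[X in _ = X - _]sum_data_prob1 -sumrB; apply: eq_bigr => t _; rewrite mulrBr mulr1.
rewrite lerD2l lerN2.
have -> : \sum_t data_prob R t * bad t =
   \sum_(K : {set 'I_N} | eps * N%:R <= #|K|%:R) Ex (data_wt R) (f1 K) ^+ M
   + expR (L) * Ex (data_wt R) f2 ^+ M.
  rewrite -sum_data_prob mulr_sumr.
  under [X in _ = X + _]eq_bigr do rewrite -sum_data_prob.
  rewrite exchange_big -big_split; apply: eq_bigr => t _.
  by rewrite /bad /= mulrDr mulr_sumr [in RHS]mulrCA.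
apply: lerD.
  apply: (@le_trans _ _ (\sum_(K : {set 'I_N}) expR (- (mgf_gap eps * M%:R)))).
    rewrite big_mkcond; apply: ler_sum => K _; case: ifP => hK; last exact: expR_ge0.
    rewrite -mulNr expRM_natr; apply: lerXn2r; rewrite ?nnegrE ?expR_ge0 ?pe //.
    by apply: Ex_ge0 => [t|x]; [exact: data_wt_ge0|exact: expR_ge0].
  by rewrite sumr_const -cardsT -powersetT card_powerset cardsT card_ord -[leLHS]mulr_natl natrX.
rewrite expRD ler_wpM2l ?expR_ge0 // -mulNr expRM_natr; apply: lerXn2r; rewrite ?nnegrE ?expR_ge0 //.
by apply: Ex_ge0 => [t|x]; [exact: data_wt_ge0|exact: expR_ge0].
Qed.

End FailureEvent.

(** * Choice of the constant and conclusion *)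

Lemma sample_size_constant (R : realType) (gap p L gam : R) :
  0 < gap -> 0 < p -> 0 <= L -> 0 < gam <= 1 ->
  exists2 c : R, 0 < c & forall (M N : nat) (delta : R), 0 < delta < 1 ->
    c * N%:R <= M%:R -> c * ln delta^-1 <= N%:R -> (0 < N)%N ->
    let bad := 2 ^+ N * expR (- (gap * M%:R)) + expR (L - p / 2 * M%:R) in
    [/\ (N < 9)%N -> 1 - delta <= 3^-1 ^+ N
      & (9 <= N)%N -> 1 - delta <= (1 - bad) * 3^-1 ^+ N \/
          1 - delta <= (1 - bad) * (1 - expR (- gam * N%:R))].
Proof.
move=> gap0 p0 L0 /andP[gam0 gam1].
pose n := Num.bound (4 / gam); pose N0 := (n + 9)%N.
have nP : 4 / gam <= n%:R.
  by apply/ltW/archi_boundP; rewrite divr_ge0 // ltW.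
have N0P : 4 / gam <= N0%:R by rewrite (le_trans nP) // ler_nat leq_addr.
(* The first two terms make both parts of [bad] at most [exp (- 2 N)], the third gives
   [exp (- gam N / 2) <= delta], and the last handles [N <= N0]. *)
pose c := 3 / gap + 2 / p * (L + 2) + 2 / gam + 2 * N0%:R * 3 ^+ N0.
have c1 : 0 < 3 / gap by rewrite divr_gt0.
have c2 : 0 < 2 / p * (L + 2) by rewrite mulr_gt0 ?divr_gt0 //; lra.
have c3 : 0 < 2 / gam by rewrite divr_gt0.
have c4 : 0 < 2 * N0%:R * 3 ^+ N0 :> R.
  by rewrite !mulr_gt0 ?exprn_gt0 // ltr0n addn_gt0 orbT.
have cge : [/\ 3 / gap <= c, 2 / p * (L + 2) <= c, 2 / gam <= c & 2 * N0%:R * 3 ^+ N0 <= c].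
  by rewrite /c; split; lra.
case: cge => cgap cp cgam cN0.
have c0 : 0 < c by apply: lt_le_trans cgap.
clearbody c; exists c => //.
move=> M N delta /andP[d0 d1] hM hl N_gt0 bad.
have N1 : 1 <= N%:R :> R by rewrite ler1n.
pose l := ln delta^-1.
have l0 : 0 < l by rewrite ln_gt0 // invf_gt1.
have dE : delta = expR (- l) by rewrite expRN lnK ?invrK // posrE invr_gt0.
have dl : 1 - delta <= l by rewrite dE; have := expR_ge1Dx (- l); lra.
(* For bounded [N], [1 - delta <= ln (1 / delta) <= N / c], so the required probability is itself
   tiny. *)
have small : (N <= N0)%N -> 1 - delta <= 2^-1 * 3^-1 ^+ N.
  move=> NN0; apply: le_trans dl _.
  have N0r : 0 < N0%:R :> R by rewrite ltr0n addn_gt0 orbT.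
  have t0 : 0 < 3 ^+ N :> R by rewrite exprn_gt0.
  rewrite exprVn -invfM -[leRHS]mul1r ler_pdivlMr ?mulr_gt0 //.
  have : 2 * N0%:R * 3 ^+ N <= c.
    apply: le_trans cN0; rewrite ler_wpM2l ?mulr_ge0 //.
    by apply: ler_weXn2l => //; lra.
  move/(ler_wpM2r (ltW l0)) => h.
  have NN : N%:R <= N0%:R :> R by rewrite ler_nat.
  have : N0%:R * (l * (2 * 3 ^+ N)) <= N0%:R * 1.
    rewrite mulr1; apply: le_trans NN; apply: le_trans hl; apply: le_trans h.
    by rewrite /l; lra.
  by rewrite ler_pM2l.
split=> [N9|N9].
  apply: (le_trans (small _)); first by rewrite (leq_trans (ltnW N9)) // leq_addl.
  by rewrite ler_piMl ?exprn_ge0 ?invr_ge0 // invf_le1 // ler1n.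
have bad0 : 0 <= bad by rewrite addr_ge0 ?mulr_ge0 ?exprn_ge0 ?expR_ge0.
have bad_le : bad <= 2 * expR (- (2 * N%:R)).
  have e2 : 2 <= expR 1 :> R by have := expR_ge1Dx (1 : R); lra.
  have b1 : 2 ^+ N * expR (- (gap * M%:R)) <= expR (- (2 * N%:R)).
    apply: (@le_trans _ _ (expR N%:R * expR (- (gap * M%:R)))).
      rewrite ler_wpM2r ?expR_ge0 // -[N%:R]mul1r expRM_natr.
      by apply: lerXn2r; rewrite ?nnegrE ?expR_ge0.
    rewrite -expRD ler_expR.
    have : 3 * N%:R <= gap * M%:R.
      apply: le_trans (ler_wpM2l (ltW gap0) hM); rewrite mulrA ler_wpM2r //.
      by rewrite mulrC -ler_pdivrMr.
    by lra.
  have b2 : expR (L - p / 2 * M%:R) <= expR (- (2 * N%:R)).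
    rewrite ler_expR.
    have p20 : 0 < p / 2 by rewrite divr_gt0.
    have h1 : (L + 2) * N%:R <= p / 2 * M%:R.
      apply: le_trans (ler_wpM2l (ltW p20) hM); rewrite mulrA ler_wpM2r //.
      apply: le_trans (ler_wpM2l (ltW p20) cp).
      by rewrite le_eqVlt; apply/orP; left; apply/eqP; field; rewrite gt_eqF.
    have : L * 1 <= L * N%:R by rewrite ler_wpM2l.
    by lra.
  by rewrite /bad; lra.
have [NN0|NN0] := leqP N N0.
  (* Here [bad <= 1/2], which the spare factor [1/2] in [small] absorbs. *)
  left; apply: le_trans (small NN0) _.
  rewrite ler_wpM2r ?exprn_ge0 ?invr_ge0 //.
  have N9' : 9 <= N%:R :> R by rewrite (ler_nat _ 9).
  have : expR (- (2 * N%:R)) <= 4^-1 :> R.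
    rewrite expRN lef_pV2 ?posrE ?expR_gt0 //.
    by have := expR_ge1Dx (2 * N%:R : R); lra.
  by lra.
right; set x := expR (- gam * N%:R).
have x0 : 0 <= x by exact: expR_ge0.
(* [bad <= 2 x], and [gam N >= 4] gives [3 x <= exp (- gam N / 2) <= delta]. *)
have : bad + x <= delta.
  have h1 : expR (- (2 * N%:R)) <= x.
    rewrite ler_expR mulNr lerN2 ler_wpM2r //; lra.
  have NN0' : 4 / gam <= N%:R by rewrite (le_trans N0P) // ler_nat ltnW.
  rewrite ler_pdivrMr // in NN0'.
  have h2 : 3 * x <= expR (- (gam / 2 * N%:R)).
    have -> : x = expR (- (gam / 2 * N%:R)) * expR (- (gam / 2 * N%:R)).
      by rewrite -expRD /x; congr expR; lra.
    rewrite mulrA ler_piMl ?expR_ge0 //.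
    rewrite expRN ler_pdivrMr ?expR_gt0 // mul1r.
    by have := expR_ge1Dx (gam / 2 * N%:R); lra.
  have h3 : expR (- (gam / 2 * N%:R)) <= delta.
    rewrite dE ler_expR lerN2.
    have : 2 / gam * l <= N%:R by apply: le_trans hl; rewrite ler_wpM2r // ltW.
    have g20 : 0 < gam / 2 by rewrite divr_gt0.
    move/(ler_wpM2l (ltW g20)); rewrite mulrA.
    by have -> : gam / 2 * (2 / gam) = 1; [field; rewrite gt_eqF | rewrite mul1r].
  by lra.
have : 0 <= bad * x by rewrite mulr_ge0.
by rewrite mulrBl mul1r mulrBr mulr1; lra.
Qed.

Theorem mainTheorem7 (R : realType) :
  exists c : R, forall (M N : nat) (delta : R) (enumI : 'I_(2 ^ M) -> {set 'I_M}),
    bijective enumI -> 0 < delta < 1 ->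
    c * Num.max (N%:R) (ln delta^-1) <= M%:R ->
    c * ln delta^-1 <= N%:R ->
    ((1 - delta)%:C%C <= probN (rhoMaj R enumI) (@failEvent R M N enumI)).
Proof.
have eps01 : 0 < (6000^-1 : R) <= 1.
  by rewrite invr_gt0 invf_le1 // ler1n ltr0n.
have tau01 : 0 <= (600^-1 : R) <= 3^-1.
  by rewrite invr_ge0 ler0n lef_pV2 ?posrE ?ltr0n // ler_nat.
have gap0 : 0 < mgf_gap (6000^-1 : R).
  case/andP: eps01 => e0 _.
  by rewrite divr_gt0 ?exprn_gt0 ?mulr_gt0 ?p0_gt0 ?expR_gt0.
have gam01 : 0 < (600^-1 : R) ^+ 2 / 4 <= 1.
  rewrite divr_gt0 ?exprn_gt0 ?invr_gt0 //= ler_pdivrMr // mul1r.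
  case/andP: tau01 => t0 t1; apply: (@le_trans _ _ 1); last by rewrite ler1n.
  by rewrite expr_le1 // (le_trans t1) // invf_le1 ?ler1n.
have L0 : 0 <= (250 : R) ^+ 2 by exact: sqr_ge0.
have [c c0 hc] := sample_size_constant gap0 (p0_gt0 R) L0 gam01.
exists c => M N delta enumI bij d01 hM hN.
(* [delta < 1] makes [c ln (1 / delta)] positive, so [N = 0] is excluded. *)
have N_gt0 : (0 < N)%N.
  rewrite -(ltr0n R); apply: lt_le_trans hN.
  by case/andP: d01 => d0 d1; rewrite mulr_gt0 // ln_gt0 // invf_gt1.
have hM' : c * N%:R <= M%:R.
  by apply: le_trans hM; rewrite ler_pM2l // le_max lexx.
have [hs hl] := hc M N delta d01 hM' hN N_gt0.
have [N9|N9] := ltnP N 9.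
  have fail_ge (t : data M N) j : predT t -> enumI j = chosen R t -> 3^-1 ^+ N <=
      \sum_s parity_prob R enumI t s * (failEvent R enumI (mk_sample t s))%:R.
    move=> _ ej; apply: (all_Z_ge (j := j)) => s ps hZ.
    exact: (small_all_Z bij N_gt0 N9 ej ps hZ).
  apply: le_trans (probN_fail_ge bij fail_ge).
  rewrite lecR; under eq_bigr do rewrite mulr1.
  by rewrite sum_data_prob1 mul1r; exact: hs.
have G := few_errs_prob M (250 ^+ 2) N9 eps01.
(* The first alternative uses only runs with every basis of qubit [M + j*] equal to Z; the second
   uses concentration of the number of Z bases. *)
case: (hl N9) => hb.
  have fail_ge (t : data M N) j : few_errs 6000^-1 ((250 : R) ^+ 2) t ->
      enumI j = chosen R t -> 3^-1 ^+ N <=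
      \sum_s parity_prob R enumI t s * (failEvent R enumI (mk_sample t s))%:R.
    move=> g ej; apply: (all_Z_ge (j := j)) => s ps hZ.
    exact: (few_errs_all_Z bij N_gt0 g ej ps hZ).
  apply: le_trans (probN_fail_ge bij fail_ge).
  by rewrite lecR; apply: le_trans hb _; rewrite ler_wpM2r ?exprn_ge0 ?invr_ge0.
have fail_ge (t : data M N) j : few_errs 6000^-1 ((250 : R) ^+ 2) t ->
    enumI j = chosen R t -> 1 - expR (- (600^-1 ^+ 2 / 4) * N%:R) <=
    \sum_s parity_prob R enumI t s * (failEvent R enumI (mk_sample t s))%:R.
  move=> g ej; apply: (many_Z_ge (j := j) tau01) => s ps hV.
  exact: (few_errs_fail bij N_gt0 g ej ps hV).
apply: le_trans (probN_fail_ge bij fail_ge).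
rewrite lecR; apply: le_trans hb _; rewrite ler_wpM2r // subr_ge0 expR_le1.
by rewrite mulNr oppr_le0 mulr_ge0 //; case/andP: gam01 => /ltW.
Qed.
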